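(* Let $G=\mathbb{GP}(\Gamma,\mathcal{G})$ be a non-degenerate graph product of (countable) groups such that $\operatorname{diam}(\Gamma)\geq 2$. Then $G$ is acylindrically arboreal if and only if $G$ is not virtually cyclic and there exists a pair of vertices $a,b\in V(\Gamma)$ that are separated.
   Context: All groups are at most countable; trees are simplicial with the edge metric, and actions on them are by simplicial isometries without inversion. Graph product: for a finite simple graph $\Gamma=(V,E)$ and groups $\mathcal{G}=\{G_v\}_{v\in V}$, $\mathbb{GP}(\Gamma,\mathcal{G})=\langle \mathcal{G}\mid [G_u,G_v]\text{ for }\{u,v\}\in E\rangle$. It is non-degenerate if no vertex group is trivial and $\Gamma$ has more than one vertex. For $A\subseteq V$, the full subgroup $G_A$ is the subgroup generated by $\{G_v: v\in A\}$ (with $G_\emptyset=\{1\}$). $\operatorname{link}_\Gamma(v)$ is the set of vertices adjacent to $v$, and $\operatorname{link}_\Gamma(A)=\bigcap_{v\in A}\operatorname{link}_\Gamma(v)$. $\operatorname{diam}(\Gamma)$ is the diameter of $V(\Gamma)$ in the edge-path metric (infinite if $\Gamma$ is disconnected). Two vertices $a,b$ are separated if their edge distance in $\Gamma$ is at least $2$ and $G_{\operatorname{link}_\Gamma(\{a,b\})}$ is finite. An action of $G$ on a metric space $(X,d)$ is acylindrical if for every $\epsilon\ge 0$ there are $R(\epsilon),N(\epsilon)\ge 0$ such that for all $x,y\in X$ with $d(x,y)\ge R(\epsilon)$, at most $N(\epsilon)$ elements $g\in G$ satisfy $d(x,gx)\le\epsilon$ and $d(y,gy)\le\epsilon$. An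 element is loxodromic if $n\mapsto g^n x$ is a quasi-isometric embedding $\mathbb{Z}\to X$. An acylindrical action on a hyperbolic space is non-elementary if $G$ contains infinitely many independent loxodromic elements (equivalently, it neither has bounded orbits nor is $G$ virtually cyclic containing a loxodromic). $G$ is acylindrically arboreal if it admits a non-elementary acylindrical action on some simplicial tree. *)

(* Defs.v *)
From Stdlib Require Import Reals ZArith List.
Import ListNotations.
Open Scope R_scope.

Record group : Type := Group {
  carrier :> Type;
  mul : carrier -> carrier -> carrier;
  one : carrier;
  inv : carrier -> carrier;
  mulA : forall x y z, mul x (mul y z) = mul (mul x y) z;
  mul1g : forall x, mul one x = x;
  mulg1 : forall x, mul x one = x;
  mulVg : forall x, mul (inv x) x = one;
  mulgV : forall x, mul x (inv x) = one }.

Arguments mul {g}. Arguments one {g}. Arguments inv {g}.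

Definition is_hom {G H : group} (f : G -> H) : Prop :=
  forall x y, f (mul x y) = mul (f x) (f y).

Definition countable (G : group) : Prop :=
  exists enc : G -> nat, forall x y, enc x = enc y -> x = y.

Definition gpow {G : group} (g : G) (z : Z) : G :=
  match z with
  | Z0 => one
  | Zpos p => Nat.iter (Pos.to_nat p) (mul g) one
  | Zneg p => Nat.iter (Pos.to_nat p) (mul (inv g)) one
  end.

Definition virtually_cyclic (G : group) : Prop :=
  exists (g : G) (s : list G), forall x : G,
    exists y k, In y s /\ x = mul y (gpow g k).

Fixpoint is_walk {T : Type} (adj : T -> T -> Prop) (x : T) (l : list T) (y : T)
  : Prop :=
  match l with
  | [] => x = y
  | z :: l' => adj x z /\ is_walk adj z l' y
  end.

Definition dist_le {T : Type} (adj : T -> T -> Prop) (x y : T) (k : nat) : Prop :=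
  exists l, is_walk adj x l y /\ (length l <= k)%nat.

(* d(x,y) >= k  (also true when x,y lie in different components) *)
Definition dist_ge {T : Type} (adj : T -> T -> Prop) (x y : T) (k : nat) : Prop :=
  forall l, is_walk adj x l y -> (k <= length l)%nat.

Definition is_dist {T : Type} (adj : T -> T -> Prop) (x y : T) (n : nat) : Prop :=
  (exists l, is_walk adj x l y /\ length l = n) /\ dist_ge adj x y n.

(* G together with iota_v : G_v -> G is the graph product GP(Gamma, G_v):
   universal property of the presentation < G_v | [G_u,G_v], {u,v} in E >. *)
Definition gp_relations {V : Type} (E : V -> V -> Prop) (Gv : V -> group)
  (H : group) (phi : forall v, Gv v -> H) : Prop :=
  (forall v, is_hom (phi v)) /\
  (forall u v, E u v -> forall (x : Gv u) (y : Gv v),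
      mul (phi u x) (phi v y) = mul (phi v y) (phi u x)).

Definition is_graph_product {V : Type} (E : V -> V -> Prop) (Gv : V -> group)
  (G : group) (iota : forall v, Gv v -> G) : Prop :=
  gp_relations E Gv G iota /\
  forall (H : group) (phi : forall v, Gv v -> H),
    gp_relations E Gv H phi ->
    exists f : G -> H, is_hom f /\ (forall v x, f (iota v x) = phi v x) /\
      forall f' : G -> H, is_hom f' -> (forall v x, f' (iota v x) = phi v x) ->
        forall g, f' g = f g.

Inductive in_full {V : Type} {Gv : V -> group} {G : group}
  (iota : forall v, Gv v -> G) (A : V -> Prop) : G -> Prop :=
  | full_one : in_full iota A one
  | full_gen : forall v (x : Gv v), A v -> in_full iota A (iota v x)
  | full_mul : forall g h, in_full iota A g -> in_full iota A h ->
               in_full iota A (mul g h)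
  | full_inv : forall g, in_full iota A g -> in_full iota A (inv g).

Definition finite_subgroup {G : group} (P : G -> Prop) : Prop :=
  exists l : list G, forall x, P x -> In x l.

Definition link2 {V : Type} (E : V -> V -> Prop) (a b : V) : V -> Prop :=
  fun w => E a w /\ E b w.

Definition separated {V : Type} (E : V -> V -> Prop) {Gv : V -> group}
  {G : group} (iota : forall v, Gv v -> G) (a b : V) : Prop :=
  dist_ge E a b 2 /\ finite_subgroup (in_full iota (link2 E a b)).

(* diam(Gamma) >= 2 (diameter infinite if disconnected) *)
Definition diam_ge2 {V : Type} (E : V -> V -> Prop) : Prop :=
  exists u v : V, dist_ge E u v 2.

Fixpoint no_backtrack {T : Type} (x : T) (l : list T) : Prop :=
  match l with
  | z :: ((w :: _) as l') => x <> w /\ no_backtrack z l'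
  | _ => True
  end.

Definition is_tree {T : Type} (adj : T -> T -> Prop) : Prop :=
  inhabited T /\
  (forall x y, adj x y -> adj y x) /\
  (forall x, ~ adj x x) /\
  (forall x y, exists l, is_walk adj x l y) /\
  (forall x l, is_walk adj x l x -> no_backtrack x l -> l = []).

Definition is_tree_action (G : group) {T : Type} (adj : T -> T -> Prop)
  (act : G -> T -> T) : Prop :=
  (forall x, act one x = x) /\
  (forall g h x, act (mul g h) x = act g (act h x)) /\
  (forall g x y, adj x y -> adj (act g x) (act g y)) /\
  (forall g x y, adj x y -> act g x = y -> act g y = x -> False).

Definition acylindrical (G : group) {T : Type} (adj : T -> T -> Prop)
  (act : G -> T -> T) : Prop :=
  forall eps : nat, exists Rr Nn : nat, forall x y : T,
    dist_ge adj x y Rr ->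
    forall gs : list G, NoDup gs ->
      (forall g, In g gs -> dist_le adj x (act g x) eps /\
                            dist_le adj y (act g y) eps) ->
      (length gs <= Nn)%nat.

Definition loxodromic (G : group) {T : Type} (adj : T -> T -> Prop)
  (act : G -> T -> T) (g : G) : Prop :=
  exists (x : T) (lam c : R), 1 <= lam /\ 0 <= c /\
    forall (m n : Z) (k : nat), is_dist adj (act (gpow g m) x) (act (gpow g n) x) k ->
      / lam * IZR (Z.abs (m - n)) - c <= INR k <= lam * IZR (Z.abs (m - n)) + c.

Definition gromov_bounded {T : Type} (adj : T -> T -> Prop) (o : T)
  (xs ys : nat -> T) : Prop :=
  exists B : nat, forall n m a b d,
    is_dist adj o (xs n) a -> is_dist adj o (ys m) b ->
    is_dist adj (xs n) (ys m) d -> (a + b <= B + d)%nat.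

Definition sgnZ (s : bool) (n : nat) : Z :=
  if s then Z.of_nat n else (- Z.of_nat n)%Z.

(* loxodromics g, h are independent: {g^+,g^-} ∩ {h^+,h^-} = ∅ in the
   boundary, i.e. g^{±n}o and h^{±m}o never converge to a common end *)
Definition independent (G : group) {T : Type} (adj : T -> T -> Prop)
  (act : G -> T -> T) (g h : G) : Prop :=
  forall (o : T) (s t : bool),
    gromov_bounded adj o (fun n => act (gpow g (sgnZ s n)) o)
                         (fun m => act (gpow h (sgnZ t m)) o).

Definition non_elementary (G : group) {T : Type} (adj : T -> T -> Prop)
  (act : G -> T -> T) : Prop :=
  exists f : nat -> G,
    (forall i j, f i = f j -> i = j) /\
    (forall i, loxodromic G adj act (f i)) /\
    (forall i j, i <> j -> independent G adj act (f i) (f j)).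

Definition acylindrically_arboreal (G : group) : Prop :=
  exists (T : Type) (adj : T -> T -> Prop) (act : G -> T -> T),
    is_tree adj /\ is_tree_action G adj act /\
    acylindrical G adj act /\ non_elementary G adj act.

(* Main.v *)
(* Write P_a, P_b for the full subgroups of G on the complements of b and a.

   If a, b are separated, G acts on the Bass-Serre tree of the amalgam of P_a and P_b over
   their intersection C.  To control it, G acts on the reduced words of a free product of
   conjugates of G_a and G_b, one for each coset of the full subgroups on link(a) and link(b):
   G_a and G_b act by left multiplication on the base factors, all other vertex groups by
   permuting the factors.  This action and the retraction onto C together determine an
   element, so alternating products do not vanish; an element fixing a path with 3 edges
   acts through an element fixing a factor of each kind, which lies in the intersection of
   a conjugate of G_link(a) with one of G_link(b), and this intersection embeds in
   G_link(a,b).  If C has index 2 in both P_a and P_b, G is virtually cyclic; otherwise three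
   cosets x, x', 1 and y on the other side give the independent elements (xy)^i (x'y)^i.

   Conversely, if no pair is separated, the full subgroup on a non-adjacent pair commutes with
   the infinite group G_link(a,b), so by acylindricity all its elements are elliptic.  Hence
   all elements of vertex groups are elliptic with pairwise common fixed points, and Helly's
   theorem for subtrees gives a global fixed point.

   All tree geometry is done with the four-point condition of the edge metric. *)
Require Import Defs.
From Stdlib Require Import List.
From Stdlib Require Import ssreflect Bool Arith ZArith Lia Reals Lra.
From Stdlib Require Import Classical ClassicalEpsilon.
From Stdlib Require Import FunctionalExtensionality PropExtensionality.
Import ListNotations.
Local Open Scope nat_scope.

(** * Trees as 0-hyperbolic integer metric spaces *)

(** [tm_fpc] is Gromov's four-point condition with constant 0. With it, geodesic points from
    [tm_between] and even perimeters from [tm_even], most tree arguments reduce to linear integer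
    arithmetic. *)
Record tree_metric {T : Type} (d : T -> T -> nat) : Prop := TreeMetric {
  tm_refl : forall x, d x x = 0;
  tm_eq : forall x y, d x y = 0 -> x = y;
  tm_sym : forall x y, d x y = d y x;
  tm_fpc : forall a b c e,
    d a b + d c e <= Nat.max (d a c + d b e) (d a e + d b c);
  tm_between : forall x y k, k <= d x y ->
    exists z, d x z = k /\ d z y = d x y - k;
  tm_even : forall x y z, exists k, d x y + d y z + d x z = 2 * k }.

Definition parity_eq (m n : nat) : Prop := exists k, m + n = 2 * k.

Lemma is_walk_app {T : Type} (adj : T -> T -> Prop) (x y z : T) l1 l2 :
  is_walk adj x l1 y -> is_walk adj y l2 z -> is_walk adj x (l1 ++ l2) z.
Proof.
elim: l1 x => [|w l1 IH] x /= => [->|[xw wy]] //.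
by move=> yz; split=> //; apply: IH.
Qed.

Definition heads_differ {T : Type} (l1 l2 : list T) : Prop :=
  match l1, l2 with
  | u :: _, w :: _ => u <> w
  | _, _ => True
  end.

Lemma no_backtrack_cons {T : Type} (x y : T) (l : list T) :
  no_backtrack y l -> (match l with w :: _ => x <> w | [] => True end) ->
  no_backtrack x (y :: l).
Proof. by case: l. Qed.

Lemma no_backtrack_tail {T : Type} (x y : T) (l : list T) :
  no_backtrack x (y :: l) -> no_backtrack y l.
Proof. by case: l => //= w l []. Qed.

Section TreeMetric.
Context {T : Type} (adj : T -> T -> Prop).
Context (adj_sym : forall x y, adj x y -> adj y x).

(** Reversing [l1] and appending [l2] cannot backtrack at [x], since non-empty walks leave [x]
    towards different vertices. The induction moves one edge of [l1] onto [l2] at a time. *)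
Lemma no_backtrack_glue x l1 l2 y z :
  is_walk adj x l1 y -> no_backtrack x l1 ->
  is_walk adj x l2 z -> no_backtrack x l2 ->
  heads_differ l1 l2 ->
  exists l, is_walk adj y l z /\ no_backtrack y l /\
            length l = length l1 + length l2.
Proof.
elim: l1 x l2 => [|w l1 IH] x l2 /=.
  by move=> <- _ h2 n2 _; exists l2.
move=> [xw wy] n1 h2 n2 hd.
have [l [h [n e]]] : exists l, is_walk adj y l z /\ no_backtrack y l /\
    length l = length l1 + length (x :: l2).
{ apply: (IH w) => //.
  - exact: no_backtrack_tail n1.
  - by split=> //; apply: adj_sym.
  - by apply: no_backtrack_cons => //; case: (l2) hd.
  - by case: (l1) n1 => //= u l' [xu _] ux; apply: xu; rewrite ux. }
by exists l; rewrite e /=; split=> //; split=> //; lia.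
Qed.

Lemma walk_reduce x l y : is_walk adj x l y ->
  exists l', is_walk adj x l' y /\ no_backtrack x l' /\ length l' <= length l /\
             parity_eq (length l) (length l').
Proof.
elim: l x => [|z l IH] x /=.
  by move=> ->; exists []; do !split => //; exists 0.
move=> [xz /IH [l' [h [n [le [k e]]]]]].
case: (classic (exists l'', l' = x :: l'')) => [[l'' E]|N].
  exists l''; move: h n le e; rewrite {}E /= => -[zx h] n le e.
  split=> //; split; first by case: (l'') n => //= ? ? [].
  by split; [lia | exists k; lia].
exists (z :: l'); split=> //; split.
  apply: no_backtrack_cons => //; case: (l') N => // w l'' N E.
  by apply: N; exists l''; rewrite E.
by split=> /=; [lia | exists (S k); lia].
Qed.

Context (conn : forall x y, exists l, is_walk adj x l y).
Context (nocycle : forall x l, is_walk adj x l x -> no_backtrack x l -> l = []).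

(** Where two reduced walks first diverge, gluing their remainders yields a reduced closed walk of
    positive length. *)
Lemma reduced_walk_unique x y l1 l2 :
  is_walk adj x l1 y -> no_backtrack x l1 ->
  is_walk adj x l2 y -> no_backtrack x l2 -> l1 = l2.
Proof.
elim: l1 x l2 => [|u l1 IH] x l2.
  by move=> /= -> _ h n; rewrite (nocycle _ _ h n).
case: l2 => [|w l2] h1 n1 h2 n2.
  by move: h2 h1 => /= <- h1; apply: (nocycle x).
case: (classic (u = w)) => [E|N].
{ subst w; congr cons; apply: (IH u) => //.
  - by case: h1.
  - exact: no_backtrack_tail n1.
  - by case: h2.
  - exact: no_backtrack_tail n2. }
have [//|l [h [n e]]] := no_backtrack_glue x _ _ y y h1 n1 h2 n2.
by move: e; rewrite (nocycle _ _ h n).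
Qed.

Lemma reduced_walk_exists x y : exists l, is_walk adj x l y /\ no_backtrack x l.
Proof.
have [l /walk_reduce [l' [h [n _]]]] := conn x y.
by exists l'.
Qed.

Definition geod x y : list T :=
  proj1_sig (constructive_indefinite_description _ (reduced_walk_exists x y)).

Definition tdist x y : nat := length (geod x y).

Lemma geodP x y : is_walk adj x (geod x y) y /\ no_backtrack x (geod x y).
Proof. by rewrite /geod; case: constructive_indefinite_description. Qed.

Lemma tdist_reduced x y l :
  is_walk adj x l y -> no_backtrack x l -> tdist x y = length l.
Proof.
move=> h n; have [h' n'] := geodP x y.
by rewrite /tdist (reduced_walk_unique x y _ _ h' n' h n).
Qed.

Lemma tdist_walk x y l : is_walk adj x l y ->
  tdist x y <= length l /\ parity_eq (length l) (tdist x y).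
Proof.
move=> /walk_reduce [l' [h [n [le p]]]].
by rewrite (tdist_reduced x y l' h n).
Qed.

Lemma tdist_sym x y : tdist x y = tdist y x.
Proof.
have [h n] := geodP x y.
have [|l [h' [n' e]]] := no_backtrack_glue x _ [] y x h n (eq_refl _) I.
  by case: (geod x y).
by rewrite (tdist_reduced y x l h' n') e /tdist /=; lia.
Qed.

Lemma tdist_tri x y z : tdist x z <= tdist x y + tdist y z.
Proof.
have [h1 _] := geodP x y; have [h2 _] := geodP y z.
have [le _] := tdist_walk _ _ _ (is_walk_app _ _ _ _ _ _ h1 h2).
by move: le; rewrite length_app.
Qed.

Lemma tdist_first x y : x <> y -> exists z l, geod x y = z :: l /\ adj x z /\
  tdist x y = S (tdist z y).
Proof.
move=> ne; have [] := geodP x y.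
rewrite /tdist; case: (geod x y) => [//|z l] [xz h] n.
exists z, l; split=> //; split=> //.
by rewrite -/(tdist z y) (tdist_reduced z y l) //; apply: no_backtrack_tail n.
Qed.

Lemma tdist_add x y z : heads_differ (geod x y) (geod x z) ->
  tdist y z = tdist x y + tdist x z.
Proof.
have [h1 n1] := geodP x y; have [h2 n2] := geodP x z.
move=> hd; have [l [h [n e]]] := no_backtrack_glue x _ _ y z h1 n1 h2 n2 hd.
by rewrite (tdist_reduced y z l).
Qed.

Lemma tdist_refl x : tdist x x = 0.
Proof. by rewrite (tdist_reduced x x []). Qed.

Lemma tdist_fpc a b c e :
  tdist a b + tdist c e <= Nat.max (tdist a c + tdist b e) (tdist a e + tdist b c).
Proof.
(* Induction on the total distance from [e]. If the three geodesics from [e] share their first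
   vertex, moving [e] there lowers all three sums by one; otherwise at least two of the three pairs
   have additive distances through [e]. *)
have [n] : exists n, tdist e a + tdist e b + tdist e c <= n by eexists; eauto.
elim: n e => [|n IH] e le.
all: have H1 := tdist_tri a e b; have H2 := tdist_tri a e c.
all: have H3 := tdist_tri b e c; have H4 := tdist_tri a c b.
all: have H5 := tdist_tri b a c; have H6 := tdist_tri a b c.
all: have E1 := tdist_sym e a; have E2 := tdist_sym e b; have E3 := tdist_sym e c.
all: have E4 := tdist_sym b a; have E5 := tdist_sym c b; have E6 := tdist_sym c a.
  by lia.
case: (classic (e = a)) => [Ea|Na]; first by subst e; lia.
case: (classic (e = b)) => [Eb|Nb]; first by subst e; lia.
case: (classic (e = c)) => [Ec|Nc]; first by subst e; rewrite tdist_refl; lia.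
have [za [la [ga [ea da]]]] := tdist_first e a Na.
have [zb [lb [gb [eb db]]]] := tdist_first e b Nb.
have [zc [lc [gc [ec dc]]]] := tdist_first e c Nc.
case: (classic (za = zb)) => [Eab|Nab]; last first.
  have Hab : tdist a b = tdist e a + tdist e b.
    by apply: tdist_add; rewrite ga gb.
  case: (classic (za = zc)) => [Eac|Nac].
    have Hbc : tdist b c = tdist e b + tdist e c.
      by apply: tdist_add; rewrite gb gc /= -Eac; congruence.
    by lia.
  have Hac : tdist a c = tdist e a + tdist e c by apply: tdist_add; rewrite ga gc.
  by lia.
case: (classic (za = zc)) => [Eac|Nac]; last first.
  have Hac : tdist a c = tdist e a + tdist e c by apply: tdist_add; rewrite ga gc.
  have Hbc : tdist b c = tdist e b + tdist e c.
    by apply: tdist_add; rewrite gb gc /= -Eab.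
  by lia.
subst zb zc; have := IH za ltac:(lia).
rewrite (tdist_sym c za) (tdist_sym b za) (tdist_sym a za).
by lia.
Qed.

Lemma tdist_between x y k : k <= tdist x y ->
  exists z, tdist x z = k /\ tdist z y = tdist x y - k.
Proof.
elim: k x => [|k IH] x le.
  by exists x; rewrite tdist_refl; split=> //; lia.
have ne : x <> y by move=> E; move: le; rewrite E tdist_refl; lia.
have [s [l [_ [xs e]]]] := tdist_first x y ne.
have [|z [e1 e2]] := IH s; first by lia.
have [le1 _] := tdist_walk x z (s :: geod s z) (conj xs (proj1 (geodP s z))).
have tri := tdist_tri x z y.
by exists z; move: le1; rewrite /= -/(tdist s z); lia.
Qed.

Lemma tdist_metric : tree_metric tdist.
Proof.
split.
- exact: tdist_refl.
- move=> x y; have [h _] := geodP x y.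
  by rewrite /tdist; case: (geod x y) h.
- exact: tdist_sym.
- exact: tdist_fpc.
- exact: tdist_between.
- move=> x y z; have [h1 _] := geodP x y; have [h2 _] := geodP y z.
  have [_ [k]] := tdist_walk _ _ _ (is_walk_app _ _ _ _ _ _ h1 h2).
  by rewrite length_app => e; exists k.
Qed.

End TreeMetric.

(** * The distance predicates of the statement in terms of an integer metric *)

Definition graph_metric {T : Type} (adj : T -> T -> Prop) (d : T -> T -> nat) : Prop :=
  forall x y, (forall l, is_walk adj x l y -> d x y <= length l) /\
    (forall l, is_walk adj x l y -> no_backtrack x l -> d x y = length l) /\
    exists l, is_walk adj x l y /\ length l = d x y.

Lemma is_tree_metric {T : Type} (adj : T -> T -> Prop) : is_tree adj ->
  exists d : T -> T -> nat, tree_metric d /\ graph_metric adj d.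
Proof.
move=> [_ [sym [_ [conn nocycle]]]].
exists (tdist adj conn); split; first exact: tdist_metric.
move=> x y; split.
  by move=> l h; have [le _] := tdist_walk adj sym conn nocycle x y l h.
split; first by move=> l h n; apply: tdist_reduced.
by exists (geod adj conn x y); split=> //; case: (geodP adj conn x y).
Qed.

Section GraphMetric.
Context {T : Type} (adj : T -> T -> Prop) (d : T -> T -> nat).
Context (gm : graph_metric adj d).

Lemma dist_geE x y k : dist_ge adj x y k <-> k <= d x y.
Proof.
have [le [_ [l [h e]]]] := gm x y.
by split=> [H|H l' /le]; [rewrite -e; apply: H | lia].
Qed.

Lemma dist_leE x y k : dist_le adj x y k <-> d x y <= k.
Proof.
have [le [_ [l [h e]]]] := gm x y.
split=> [[l' [/le le1 le2]]|H]; first lia.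
by exists l; rewrite e.
Qed.

Lemma is_distE x y n : is_dist adj x y n <-> n = d x y.
Proof.
have [le [_ [l [h e]]]] := gm x y.
split=> [[[l' [h' e']] /dist_geE ge]|->].
  by have := le l' h'; lia.
by split; [exists l | apply/dist_geE].
Qed.

Lemma act_isometry (G : group) (act : G -> T -> T) :
  is_tree_action G adj act -> forall g x y, d (act g x) (act g y) = d x y.
Proof.
move=> [act1 [actM [actE _]]].
have step g x y : d (act g x) (act g y) <= d x y.
  have [_ [_ [l [h <-]]]] := gm x y.
  suff h' : is_walk adj (act g x) (map (act g) l) (act g y).
    by rewrite -(length_map (act g) l); apply: (proj1 (gm _ _)).
  elim: l x h => [|z l IH] x /= => [-> //|[xz h]].
  by split; [apply: actE | apply: IH].
move=> g x y; apply: Nat.le_antisymm; first exact: step.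
have := step (inv g) (act g x) (act g y).
by rewrite -!actM !mulVg !act1.
Qed.

Lemma act_no_inversion (G : group) (act : G -> T -> T) :
  is_tree_action G adj act ->
  forall g x, d x (act g x) = 1 -> act g (act g x) <> x.
Proof.
move=> [_ [_ [_ noinv]]] g x e E.
have [_ [_ [l [h]]]] := gm x (act g x); rewrite e.
case: l h => [//|y [|//]] /= [xy E'] _; subst y.
exact: (noinv g x (act g x)).
Qed.

End GraphMetric.

(** * Elementary group theory *)

Section GroupTheory.
Context {G : group}.
Implicit Types x y z g h : G.

Lemma mulKg x y : mul (inv x) (mul x y) = y.
Proof. by rewrite mulA mulVg mul1g. Qed.

Lemma mulVKg x y : mul x (mul (inv x) y) = y.
Proof. by rewrite mulA mulgV mul1g. Qed.

Lemma mulgI x y z : mul x y = mul x z -> y = z.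
Proof. by move=> E; rewrite -(mulKg x y) E mulKg. Qed.

Lemma mulIg x y z : mul y x = mul z x -> y = z.
Proof. by move=> E; rewrite -(mulg1 _ y) -(mulgV _ x) mulA E -mulA mulgV mulg1. Qed.

Lemma invgK x : inv (inv x) = x.
Proof. by apply: (mulgI (inv x)); rewrite mulVg mulgV. Qed.

Lemma invMg x y : inv (mul x y) = mul (inv y) (inv x).
Proof. by apply: (mulgI (mul x y)); rewrite mulgV -mulA mulVKg mulgV. Qed.

Lemma invg1 : inv one = one :> G.
Proof. by apply: (mulgI one); rewrite mulgV mul1g. Qed.

Lemma inv_unique x y : mul x y = one -> y = inv x.
Proof. by move=> E; apply: (mulgI x); rewrite E mulgV. Qed.
End GroupTheory.

Hint Rewrite @invMg @invgK @invg1 @mul1g @mulg1 @mulVg @mulgV @mulKg @mulVKg : grp.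
Hint Rewrite <- @mulA : grp.
Ltac grp := autorewrite with grp; try done.

Lemma hom_one {G H : group} (f : G -> H) : is_hom f -> f one = one.
Proof. by move=> hf; apply: (mulgI (f one)); rewrite -hf !mulg1. Qed.

Lemma hom_inv {G H : group} (f : G -> H) x : is_hom f -> f (inv x) = inv (f x).
Proof. by move=> hf; apply: inv_unique; rewrite -hf mulgV hom_one. Qed.

Section Powers.
Context {G : group}.
Implicit Types (g h : G) (m n : Z).

Lemma gpow_succ g n : gpow g (Z.succ n) = mul g (gpow g n).
Proof.
case: n => [|p|p]; first by [].
  have -> : Z.succ (Z.pos p) = Z.pos (Pos.succ p) by lia.
  by rewrite /= Pos2Nat.inj_succ.
elim/Pos.peano_ind: p => [|p _]; first by rewrite /=; grp.
have -> : Z.succ (Z.neg (Pos.succ p)) = Z.neg p by lia.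
by rewrite /= Pos2Nat.inj_succ /= mulVKg.
Qed.

Lemma gpow1 g : gpow g 1 = g.
Proof. by rewrite /= mulg1. Qed.

Lemma gpow_pred g n : gpow g (Z.pred n) = mul (inv g) (gpow g n).
Proof. by apply: (mulgI g); rewrite -gpow_succ Z.succ_pred mulVKg. Qed.

Lemma gpow_add g m n : gpow g (m + n) = mul (gpow g m) (gpow g n).
Proof.
elim/Z.peano_ind: m => [|m IH|m IH]; first by rewrite Z.add_0_l mul1g.
  by rewrite Z.add_succ_l !gpow_succ IH mulA.
by rewrite Z.add_pred_l !gpow_pred IH mulA.
Qed.

Lemma gpow_opp g n : gpow g (- n) = inv (gpow g n).
Proof. by apply: inv_unique; rewrite -gpow_add Z.add_opp_diag_r. Qed.

Lemma gpow_inv g n : gpow (inv g) n = gpow g (- n).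
Proof.
elim/Z.peano_ind: n => [|n IH|n IH] //.
  by rewrite Z.opp_succ gpow_succ gpow_pred IH.
by rewrite Z.opp_pred gpow_succ gpow_pred IH invgK.
Qed.

Lemma gpow_mul g m n : gpow g (m * n) = gpow (gpow g m) n.
Proof.
elim/Z.peano_ind: n => [|n IH|n IH]; first by rewrite Z.mul_0_r.
  by rewrite Z.mul_succ_r Z.add_comm gpow_add gpow_succ IH.
rewrite Z.mul_pred_r gpow_pred -IH -gpow_opp -gpow_add.
by congr gpow; lia.
Qed.

Lemma commute_inv g h : mul g h = mul h g -> mul (inv g) h = mul h (inv g).
Proof. by move=> C; apply: (mulgI g); rewrite mulVKg mulA C -mulA mulgV mulg1. Qed.

Lemma gpow_commute g h n : mul g h = mul h g -> mul (gpow g n) h = mul h (gpow g n).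
Proof.
move=> C; elim/Z.peano_ind: n => [|n IH|n IH]; first by grp.
  by rewrite gpow_succ -mulA IH mulA C mulA.
by rewrite gpow_pred -mulA IH mulA (commute_inv g h C) -mulA.
Qed.

Lemma gpow_mul_commute g h n : mul g h = mul h g ->
  gpow (mul g h) n = mul (gpow g n) (gpow h n).
Proof.
move=> C; elim/Z.peano_ind: n => [|n IH|n IH]; first by grp.
  rewrite !gpow_succ IH -!mulA; congr mul; rewrite !mulA; congr mul.
  by rewrite (gpow_commute g h).
rewrite !gpow_pred IH C invMg -!mulA; congr mul; rewrite !mulA; congr mul.
by rewrite (gpow_commute g (inv h)) // (commute_inv h g).
Qed.

End Powers.

Lemma hom_gpow {G H : group} (f : G -> H) g n : is_hom f -> f (gpow g n) = gpow (f g) n.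
Proof.
move=> hf; elim/Z.peano_ind: n => [|n IH|n IH]; first exact: hom_one.
  by rewrite !gpow_succ hf IH.
by rewrite !gpow_pred hf IH hom_inv.
Qed.

(** * Geometry of isometries of a tree *)

Lemma exists_min (P : nat -> Prop) : (exists n, P n) ->
  exists n, P n /\ forall m, P m -> n <= m.
Proof.
move=> [n]; elim/(well_founded_induction lt_wf): n => n IH Pn.
case: (classic (exists m, m < n /\ P m)) => [[m [lt Pm]]|N]; first exact: (IH m).
exists n; split=> // m Pm; case: (le_lt_dec n m) => // lt.
by case: N; exists m.
Qed.

Lemma exists_max (P : nat -> Prop) (D : nat) : (exists n, P n) ->
  (forall n, P n -> n <= D) -> exists n, P n /\ forall m, P m -> m <= n.
Proof.
move=> [n Pn] bd.
have [|k [Pk kmin]] := exists_min (fun k => k <= D /\ P (D - k)).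
  exists (D - n); have := bd n Pn => le; split; first lia.
  by replace (D - (D - n)) with n by lia.
exists (D - k); case: Pk => kD Pk; split=> // m Pm.
have le := bd m Pm.
suff : k <= D - m by lia.
by apply: kmin; split; [lia | replace (D - (D - m)) with m by lia].
Qed.

Ltac four_points tm a b c e :=
  have := tm_fpc _ tm a b c e; have := tm_fpc _ tm a c b e; have := tm_fpc _ tm a e b c;
  have := tm_sym _ tm a b; have := tm_sym _ tm a c; have := tm_sym _ tm a e;
  have := tm_sym _ tm b c; have := tm_sym _ tm b e; have := tm_sym _ tm c e.

Section TreeGeometry.
Context {T : Type} (d : T -> T -> nat) (tm : tree_metric d).

Lemma tm_tri x y z : d x z <= d x y + d y z.
Proof.
have := tm_fpc d tm x z y y; rewrite (tm_refl d tm) (tm_sym d tm z y); lia.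
Qed.

(** In a tree, geodesics that overlap in a segment of positive length fit together to a geodesic:
    the passage from local to global geodesics. *)
Lemma between_trans x y z t : d x z = d x y + d y z -> d y t = d y z + d z t ->
  0 < d y z -> d x t = d x y + d y z + d z t.
Proof. by four_points tm x y z t; have := tm_tri x y t; lia. Qed.

Lemma between_unique x y u v : d x u + d u y = d x y -> d x v + d v y = d x y ->
  d x u = d x v -> u = v.
Proof. by move=> H1 H2 E; apply: (tm_eq d tm); four_points tm x y u v; lia. Qed.

Lemma median a b c : exists m, d a m + d m b = d a b /\
  d a m + d m c = d a c /\ d b m + d m c = d b c.
Proof.
have [k E] := tm_even d tm a b c.
(* [k] is half the perimeter, so [k - d b c] is the Gromov product of [b] and [c] at [a], the
   distance from [a] to the median. *)
have [|m [E1 E2]] := tm_between d tm a b (k - d b c).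
  by have := tm_tri a b c; lia.
by exists m; four_points tm a b c m; have := tm_tri a b c; have := tm_tri b a c;
  have := tm_tri a m c; have := tm_tri b m c; lia.
Qed.

Definition convex (C : T -> Prop) : Prop :=
  forall x y z, C x -> C y -> d x z + d z y = d x y -> C z.

Lemma convexI (C D : T -> Prop) : convex C -> convex D -> convex (fun x => C x /\ D x).
Proof.
by move=> hC hD x y z [cx dx] [cy dy] e; split; [apply: (hC x y) | apply: (hD x y)].
Qed.

(** The median of three points chosen in the pairwise intersections lies on all three segments
    between them, hence in every set. *)
Lemma helly3 (C1 C2 C3 : T -> Prop) : convex C1 -> convex C2 -> convex C3 ->
  (exists x, C1 x /\ C2 x) -> (exists x, C1 x /\ C3 x) -> (exists x, C2 x /\ C3 x) ->
  exists x, C1 x /\ C2 x /\ C3 x.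
Proof.
move=> h1 h2 h3 [a [a1 a2]] [b [b1 b3]] [c [c2 c3]].
have [m [ab [ac bc]]] := median a b c; exists m.
by split; [apply: (h1 a b) | split; [apply: (h2 a c) | apply: (h3 b c)]].
Qed.

(** The median of [o], [p], [q] lies in [C] and on the segment from [o] to [p], so minimality of [p]
    forces it to be [p]. *)
Lemma gate (C : T -> Prop) o p q : convex C -> C p -> (forall x, C x -> d o p <= d o x) ->
  C q -> d o q = d o p + d p q.
Proof.
move=> hC Cp pmin Cq; have [m [op [oq pq]]] := median o p q.
have le : d o p <= d o m by apply: pmin; apply: (hC p q).
have E : d m p = 0 by lia.
by move: oq; rewrite (tm_eq d tm _ _ E); lia.
Qed.

Lemma closest_point (C : T -> Prop) o : (exists x, C x) ->
  exists p, C p /\ forall x, C x -> d o p <= d o x.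
Proof.
move=> [x Cx].
have [|n [[p [Cp E]] nmin]] := exists_min (fun n => exists p, C p /\ d o p = n).
  by exists (d o x), x.
by exists p; split=> // y Cy; rewrite E; apply: nmin; exists y.
Qed.

(** * Helly's theorem for families of subtrees *)

Section Helly.
Context {S : Type} (F : S -> T -> Prop) (F_convex : forall s, convex (F s)).

Definition all_of (l : list S) (x : T) : Prop := forall s, In s l -> F s x.

Lemma all_of_convex l : convex (all_of l).
Proof. by move=> x y z ax ay e s sl; apply: (F_convex s x y) => //; auto. Qed.

(** Each step absorbs one set into [C]; by [helly3] the remaining sets still meet the smaller
    [C]. *)
Lemma helly_list (C : T -> Prop) l : convex C -> (exists x, C x) ->
  (forall s, In s l -> exists x, C x /\ F s x) ->
  (forall s t, In s l -> In t l -> exists x, F s x /\ F t x) ->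
  exists x, C x /\ all_of l x.
Proof.
elim: l C => [|s l IH] C hC nC CF FF.
  by have [x Cx] := nC; exists x; split=> // ? [].
have [||||x [[Cx Fx] H]] := IH (fun x => C x /\ F s x).
- exact: convexI.
- by apply: CF; left.
- move=> t tl; have Cs : exists x, C x /\ F s x by apply: CF; left.
  have Ct : exists x, C x /\ F t x by apply: CF; right.
  have st : exists x, F s x /\ F t x by apply: FF; [left | right].
  have [x [Cx [sx tx]]] := helly3 C (F s) (F t) hC (F_convex s) (F_convex t) Cs Ct st.
  by exists x.
- by move=> t u tl ul; apply: FF; right.
- by exists x; split=> // t [<-|/H].
Qed.

(* Trees need not be locally finite: the compactness of a bounded intersection is
   replaced by maximality of the distance from the base point [o], which the gate
   property turns into a stabilising nearest point. *)
Lemma helly_bounded (Q : S -> Prop) (l0 : list S) (o : T) (D : nat) :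
  (forall s t, Q s -> Q t -> exists x, F s x /\ F t x) ->
  (forall s, In s l0 -> Q s) ->
  (forall x, all_of l0 x -> d o x <= D) ->
  exists x, forall s, Q s -> F s x.
Proof.
move=> FF Ql0 bd.
have fin l : (forall s, In s l -> Q s) -> exists x, all_of l x.
{ move=> Ql; have [||||x [_ H]] := helly_list (fun _ => True) l.
  - by [].
  - by exists o.
  - by move=> s /Ql Qs; have [x [Fx _]] := FF s s Qs Qs; exists x.
  - by move=> s t /Ql Qs /Ql Qt; apply: FF.
  - by exists x. }
pose P m := exists l, (forall s, In s l -> Q s) /\ forall x, all_of l x -> m <= d o x.
have [||m [[l [Ql lm]] mmax]] := exists_max P D.
- by exists 0, []; split=> [? []|x _]; lia.
- move=> m [l [Ql lm]].
  have [|x Hx] := fin (l ++ l0); first by move=> s sl; case: (in_app_or _ _ _ sl); auto.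
  have := lm x (fun s H => Hx s (in_or_app _ _ _ (or_introl H))).
  by have := bd x (fun s H => Hx s (in_or_app _ _ _ (or_intror H))); lia.
- have [p [lp pmin]] := closest_point (all_of l) o (fin l Ql).
  have Ep : d o p = m.
    by apply: Nat.le_antisymm; [apply: mmax; exists l | apply: lm].
  exists p => s Qs.
  have Qsl : forall t, In t (s :: l) -> Q t by move=> t [<-|/Ql].
  have [q [slq qmin]] := closest_point (all_of (s :: l)) o (fin _ Qsl).
  have lq : all_of l q by move=> t tl; apply: slq; right.
  have le : d o q <= m by apply: mmax; exists (s :: l).
  have E := gate _ o p q (all_of_convex l) lp pmin lq.
  have -> : p = q by apply: (tm_eq d tm); lia.
  by apply: slq; left.
Qed.
End Helly.

(** * Elliptic and hyperbolic isometries *)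

Section Action.
Context {G : group} (act : G -> T -> T).
Context (act1 : forall x, act one x = x)
        (actM : forall g h x, act (mul g h) x = act g (act h x))
        (iso : forall g x y, d (act g x) (act g y) = d x y).

(** The inequality at one point already gives unbounded orbits ([hyperbolic_displacement]); its
    failure everywhere gives a fixed point when there are no inversions
    ([fixed_of_not_hyperbolic]). *)
Definition hyperbolic (g : G) : Prop :=
  exists x, d x (act g x) < d x (act g (act g x)).

Definition Fix (g : G) (x : T) : Prop := act g x = x.

Lemma actK g x : act (inv g) (act g x) = x.
Proof. by rewrite -actM mulVg act1. Qed.

Lemma actVK g x : act g (act (inv g) x) = x.
Proof. by rewrite -actM mulgV act1. Qed.

Lemma Fix_convex g : convex (Fix g).
Proof.
move=> x y z gx gy e.
have e1 := iso g x z; have e2 := iso g z y; rewrite gx in e1; rewrite gy in e2.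
by apply: (between_unique x y); lia.
Qed.

Lemma Fix_gpow g x n : Fix g x -> Fix (gpow g n) x.
Proof.
rewrite /Fix => gx; elim/Z.peano_ind: n => [|n IH|n IH]; first exact: act1.
  by rewrite gpow_succ actM IH.
by rewrite gpow_pred actM IH -{1}gx actK.
Qed.

(** A point of least displacement is fixed: displacement one would by parity be an inversion, and
    for larger displacement the first point on the segment from [x] to [g x] would move less. *)
Lemma fixed_of_not_hyperbolic (x0 : T)
  (noinv : forall g x, d x (act g x) = 1 -> act g (act g x) <> x) g :
  ~ hyperbolic g -> exists x, Fix g x.
Proof.
move=> nh.
have [x [_ xmin]] : exists x, True /\ forall y, True -> d x (act g x) <= d y (act g y).
  have [|n [[p E] nmin]] := exists_min (fun n => exists p, d p (act g p) = n).
    by exists (d x0 (act g x0)), x0.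
  by exists p; split=> // y _; rewrite E; apply: nmin; exists y.
exists x.
have le : d x (act g (act g x)) <= d x (act g x).
  by case: (le_lt_dec (d x (act g (act g x))) (d x (act g x))) => // lt; case: nh; exists x.
have e1 := iso g x (act g x).
case E: (d x (act g x)) => [|[|D]].
- by symmetry; apply: (tm_eq d tm).
- have [k Ek] := tm_even d tm x (act g x) (act g (act g x)).
  case: (noinv g x E); symmetry; apply: (tm_eq d tm); lia.
- have [|y [E1 E2]] := tm_between d tm x (act g x) 1; first lia.
  have := xmin y I.
  have e2 := iso g x y; have e3 := iso g y (act g x).
  four_points tm x (act g y) (act g x) (act g (act g x)).
  four_points tm y (act g y) (act g x) x.
  by lia.
Qed.

(* If [p] is the point of [Fix g] nearest to [q], the segment [q, g q] has midpoint [p];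
   so nearest fixed points at positive distance make [g h] a translation. *)
Lemma Fix_meet g h : (exists p, Fix g p) -> (exists q, Fix h q) ->
  ~ hyperbolic (mul g h) -> exists x, Fix g x /\ Fix h x.
Proof.
move=> [p0 gp0] [q0 hq0] nh.
have [n [[p [q [gp [hq E]]]] nmin]] :
  exists n, (exists p q, Fix g p /\ Fix h q /\ d p q = n) /\
    forall m, (exists p q, Fix g p /\ Fix h q /\ d p q = m) -> n <= m.
  by apply: exists_min; exists (d p0 q0), p0, q0.
case: n E nmin => [|n] E nmin.
  by exists p; split=> //; rewrite (tm_eq d tm _ _ E).
(* Since [h] fixes [q], the product moves [q] by [2 * d p q], and its square moves [q] by
   [4 * d p q]. *)
case: nh; exists q; rewrite !actM hq.
have reflect u v w k : Fix k u -> (forall x, Fix k x -> d u v <= d x v) ->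
    0 < d u v -> w = act k v -> d v w = 2 * d u v.
  move=> ku umin pos ->.
  have [m [H1 [H2 H3]]] := median u v (act k v).
  have e := iso k u v; have e' := iso k u m; rewrite ku in e e'.
  have km : Fix k m.
    have Hkm : d u (act k m) + d (act k m) (act k v) = d u (act k v).
      by rewrite e' iso e.
    by apply: (between_unique u (act k v)) => //; lia.
  have := umin m km; rewrite (tm_sym d tm v m) in H3; lia.
have Rg : d q (act g q) = 2 * d p q.
  apply: (reflect p q _ g) => //; last by lia.
  by move=> x gx; rewrite E; apply: nmin; exists x, q.
have Rh : d p (act h p) = 2 * d p q.
  rewrite (tm_sym d tm p q); apply: (reflect q p _ h) => //; last first.
    by rewrite (tm_sym d tm q p); lia.
  by move=> x hx; rewrite !(tm_sym d tm _ p) E; apply: nmin; exists p, x.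
have dF k u v : Fix k u -> d u (act k v) = d u v by move=> ku; rewrite -(iso k u v) ku.
have s1 : d p (act g q) = d p q by apply: dF.
have s2 : d q (act h p) = d q p by apply: dF.
have s3 : d (act h p) (act h (act g q)) = d p q by rewrite iso dF.
have s4 : d q (act h (act g q)) = 2 * d p q by rewrite dF.
have sq := tm_sym d tm p q; have sh := tm_sym d tm q (act h p).
have s5 : d p (act h (act g q)) = 3 * d p q.
  by have := between_trans p q (act h p) (act h (act g q)); lia.
have s6 : d p (act g (act h (act g q))) = 3 * d p q by rewrite dF.
have s7 : d (act g q) (act g (act h (act g q))) = 2 * d p q by rewrite iso.
have := tm_sym d tm (act g q) p.
by have := between_trans q p (act g q) (act g (act h (act g q))); lia.
Qed.

Lemma hyperbolic_displacement g x : d x (act g x) < d x (act g (act g x)) ->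
  forall n, S n <= d x (act (gpow g (Z.of_nat (S n))) x).
Proof.
move=> lt.
pose A n := d x (act (gpow g (Z.of_nat n)) x).
have step m n : d (act (gpow g (Z.of_nat m)) x) (act (gpow g (Z.of_nat (m + n))) x) = A n.
  by rewrite Nat2Z.inj_add gpow_add actM iso.
have A1 : A 1 = d x (act g x) by rewrite /A gpow1.
have A2 : A 2 = d x (act g (act g x)) by rewrite /A /= mulg1 actM.
have pos : 0 < A 1.
  case: (Nat.eq_0_gt_0_cases (A 1)) => // E0.
  by have := tm_eq d tm x (act g x); rewrite -A1 E0 => /(_ eq_refl) E;
    move: lt; rewrite -E -E (tm_refl d tm); lia.
(* From index 1 on, [A] is arithmetic with difference [A 2 - A 1], the translation length. The
   four-point condition is applied to [x] and its images under the powers 1, [2 + n] and [3 + n] of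
   [g]. *)
have prog n : A 1 < A (2 + n) /\ A (2 + n) = A (1 + n) + (A 2 - A 1) /\ A 1 <= A (1 + n).
  elim: n => [|n [IH1 [IH2 IH3]]]; first by rewrite A1 A2 /=; lia.
  have := step 1 (1 + n); have := step 1 (2 + n); have := step (2 + n) 1.
  rewrite (Nat.add_comm (2 + n) 1) /=.
  have := step 0 (2 + n); have := step 0 (3 + n).
  rewrite /= -/(A 1).
  have E1 : act (gpow g (Z.of_nat 0)) x = x by rewrite act1.
  rewrite E1.
  four_points tm x (act (gpow g (Z.of_nat 1)) x) (act (gpow g (Z.of_nat (2 + n))) x)
    (act (gpow g (Z.of_nat (3 + n))) x).
  have := step 0 1; rewrite E1 /=.
  rewrite /= in IH1 IH2 IH3 *; lia.
elim=> [|n IH]; first exact: pos.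
by have := prog n; rewrite -/(A (S (S n))) -/(A (S n)) in IH *; rewrite /= A1 A2; lia.
Qed.

(* Choosing [k] minimal, the four points [y, g^(k-1) x, g^k x, g^(k+1) x] would violate
   the four-point condition if [y] were farther than the displacement of [x]. *)
Lemma commuting_near_orbit g l x : mul l g = mul g l ->
  d x (act g x) < d x (act g (act g x)) ->
  exists k, d (act l x) (act (gpow g k) x) <= d x (act g x).
Proof.
move=> C lt; set y := act l x.
have ey : d y (act g y) = d x (act g x) by rewrite /y -actM -C actM iso.
have [n [[k E] nmin]] : exists n, (exists k, d y (act (gpow g k) x) = n) /\
    forall m, (exists k, d y (act (gpow g k) x) = m) -> n <= m.
  by apply: exists_min; exists (d y x), 0%Z; rewrite act1.
exists k; set z := act (gpow g k) x in E *.
have ez : d z (act g z) = d x (act g x).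
  by rewrite /z -actM -gpow_succ -Z.add_1_r gpow_add gpow1 actM iso.
have egz : d z (act g (act g z)) = d x (act g (act g x)).
  rewrite /z -!actM -?mulA -!gpow_succ.
  have -> : Z.succ (Z.succ k) = (k + 2)%Z by lia.
  by rewrite gpow_add actM iso /= mulg1 !actM.
set z' := act (inv g) z.
have gz' : act g z' = z by apply: actVK.
have n1 : n <= d y (act g z).
  by apply: nmin; exists (Z.succ k); rewrite gpow_succ actM.
have n2 : n <= d y z'.
  by apply: nmin; exists (Z.pred k); rewrite gpow_pred actM.
have e1 : d (act g y) (act g z) = d y z by apply: iso.
have e2 : d (act g y) z = d y z' by rewrite -{1}gz' iso.
have e3 : d z' z = d z (act g z) by rewrite -(iso g z' z) gz'.
have e4 : d z' (act g z) = d z (act g (act g z)).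
  by rewrite -(iso g z' (act g z)) gz'.
four_points tm y (act g y) z (act g z); four_points tm y z z' (act g z).
by lia.
Qed.
End Action.
End TreeGeometry.

(** * Full subgroups and retractions of a graph product *)

Section FullSubgroups.
Context {V : Type} {E : V -> V -> Prop} {Gv : V -> group} {G : group}
  {iota : forall v, Gv v -> G}.
Context (E_irr : forall v, ~ E v v) (GP : is_graph_product E Gv G iota).

Lemma iota_hom v : is_hom (iota v).
Proof. by case: GP => [[h _] _]; apply: h. Qed.

Lemma iota_commute u v (x : Gv u) (y : Gv v) : E u v ->
  mul (iota u x) (iota v y) = mul (iota v y) (iota u x).
Proof. by case: GP => [[_ c] _] uv; apply: c. Qed.

Lemma full_left_ind (A : V -> Prop) (P : G -> Prop) : P one ->
  (forall v x g, A v -> in_full iota A g -> P g -> P (mul (iota v x) g)) ->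
  forall g, in_full iota A g -> P g.
Proof.
move=> P1 PS g fg.
(* Left multiplication by [g] and by [inv g] are treated together, so that the induction passes
   through inverses. *)
suff [H _] : (forall h, in_full iota A h -> P h -> P (mul g h)) /\
             (forall h, in_full iota A h -> P h -> P (mul (inv g) h)).
  by rewrite -(mulg1 _ g); apply: H => //; apply: full_one.
elim: g / fg => [|v x Av|g h fg [g1 g2] fh [h1 h2]|g fg [g1 g2]].
- by split=> h fh Ph; grp.
- split=> h fh Ph; first exact: PS.
  by rewrite -(hom_inv _ _ (iota_hom v)); apply: PS.
- split=> k fk Pk; rewrite ?invMg -mulA.
    by apply: (g1 _ _ (h1 k fk Pk)); apply: full_mul.
  by apply: (h2 _ _ (g2 k fk Pk)); apply: full_mul => //; apply: full_inv.
- by split=> //; rewrite invgK.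
Qed.

Lemma full_mono (A B : V -> Prop) g : (forall v, A v -> B v) ->
  in_full iota A g -> in_full iota B g.
Proof.
move=> AB; elim=> [|v x Av|h k _ fh _ fk|h _ fh].
- exact: full_one.
- by apply: full_gen; apply: AB.
- exact: full_mul.
- exact: full_inv.
Qed.

Lemma full_centralizes (A : V -> Prop) h :
  (forall v (x : Gv v), A v -> mul (iota v x) h = mul h (iota v x)) ->
  forall g, in_full iota A g -> mul g h = mul h g.
Proof.
move=> C g; elim=> [|v x Av|g1 g2 _ e1 _ e2|g1 _ e1].
- by grp.
- exact: C.
- by rewrite -mulA e2 !mulA e1.
- exact: commute_inv.
Qed.

Lemma full_commute (A B : V -> Prop) g h : (forall u v, A u -> B v -> E u v) ->
  in_full iota A g -> in_full iota B h -> mul g h = mul h g.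
Proof.
move=> AB fg fh; apply: (full_centralizes A h _ g fg) => u x Au.
symmetry; apply: (full_centralizes B _ _ h fh) => v y Bv.
by symmetry; apply: iota_commute; apply: AB.
Qed.

Definition cut (A : V -> Prop) v (x : Gv v) : G :=
  match excluded_middle_informative (A v) with left _ => iota v x | right _ => one end.

(** Killing the vertex groups outside [A] respects the commutation relations, so the universal
    property supplies a retraction onto the full subgroup on [A]. *)
Lemma retr_exists (A : V -> Prop) : exists f : G -> G,
  is_hom f /\ forall v x, f (iota v x) = cut A v x.
Proof.
have [|f [hf [ef _]]] := proj2 GP G (cut A); last by exists f.
split=> [v x y|u v uv x y]; rewrite /cut.
  by case: excluded_middle_informative => _; [apply: iota_hom | grp].
case: excluded_middle_informative => _; case: excluded_middle_informative => _; grp.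
exact: iota_commute.
Qed.

Definition retr (A : V -> Prop) : G -> G :=
  proj1_sig (constructive_indefinite_description _ (retr_exists A)).

Lemma retr_hom A : is_hom (retr A).
Proof. by rewrite /retr; case: constructive_indefinite_description => f []. Qed.

Lemma retr_gen A v x : retr A (iota v x) = cut A v x.
Proof. by rewrite /retr; case: constructive_indefinite_description => f []. Qed.

Lemma retr_in A v x : A v -> retr A (iota v x) = iota v x.
Proof. by rewrite retr_gen /cut; case: excluded_middle_informative. Qed.

Lemma retr_out A v x : ~ A v -> retr A (iota v x) = one.
Proof. by rewrite retr_gen /cut; case: excluded_middle_informative. Qed.

Lemma retr_id A g : in_full iota A g -> retr A g = g.
Proof.
have h := retr_hom A; elim=> [|v x Av|g1 g2 _ e1 _ e2|g1 _ e1].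
- exact: hom_one.
- exact: retr_in.
- by rewrite h e1 e2.
- by rewrite hom_inv // e1.
Qed.

Lemma retr_full A B g : in_full iota B g ->
  in_full iota (fun v => A v /\ B v) (retr A g).
Proof.
have h := retr_hom A; elim=> [|v x Bv|g1 g2 _ e1 _ e2|g1 _ e1].
- by rewrite hom_one //; apply: full_one.
- case: (classic (A v)) => [Av|nAv]; last by rewrite retr_out //; apply: full_one.
  by rewrite retr_in //; apply: full_gen.
- by rewrite h; apply: full_mul.
- by rewrite hom_inv //; apply: full_inv.
Qed.

Lemma retr_trivial A B g : (forall v, B v -> ~ A v) -> in_full iota B g -> retr A g = one.
Proof.
have h := retr_hom A; move=> AB; elim=> [|v x Bv|g1 g2 _ e1 _ e2|g1 _ e1].
- exact: hom_one.
- by apply: retr_out; apply: AB.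
- by rewrite h e1 e2 mulg1.
- by rewrite hom_inv // e1 invg1.
Qed.

Lemma full_inter A B g : in_full iota A g -> in_full iota B g ->
  in_full iota (fun v => A v /\ B v) g.
Proof. by move=> fA /(retr_full A); rewrite retr_id. Qed.

(** The homomorphism to [Gv v] that kills all other vertex groups is a left inverse of [iota v]. Its
    family [phi] satisfies the relations because [E] is irreflexive. *)
Lemma iota_eq1 v (x : Gv v) : iota v x = one -> x = one.
Proof.
pose phi u (y : Gv u) : Gv v :=
  match excluded_middle_informative (u = v) with
  | left e => eq_rect u (fun w => carrier (Gv w)) y v e
  | right _ => one
  end.
have [|f [hf [ef _]]] := proj2 GP (Gv v) phi.
  split=> [u y z|u w uw y z]; rewrite /phi.
    by case: excluded_middle_informative => [e|_]; [subst u | grp].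
  case: excluded_middle_informative => [e1|_]; case: excluded_middle_informative => [e2|_]; grp.
  by subst u; case: (E_irr v); rewrite -{2}e2.
move=> e1; have := ef v x; rewrite e1 hom_one // /phi.
case: excluded_middle_informative => // e.
by rewrite (proof_irrelevance _ e eq_refl).
Qed.

Lemma iota_not_full v (x : Gv v) A : x <> one -> ~ A v -> ~ in_full iota A (iota v x).
Proof.
move=> nx nA /retr_id; rewrite retr_out // => e.
by apply: nx; apply: iota_eq1.
Qed.

(** The subgroup [N] generated by the vertex groups receives a homomorphism from [G]; followed by
    the inclusion it agrees with the identity on generators, hence everywhere by uniqueness. *)
Lemma graph_product_generated g : in_full iota (fun _ => True) g.
Proof.
pose N := {g : G | in_full iota (fun _ => True) g}.
have ext (x y : N) : proj1_sig x = proj1_sig y -> x = y.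
  by apply: eq_sig_hprop => ? ? ?; apply: proof_irrelevance.
pose mulN (x y : N) : N := exist _ _ (full_mul _ _ _ _ (proj2_sig x) (proj2_sig y)).
pose oneN : N := exist _ _ (full_one _ _).
pose invN (x : N) : N := exist _ _ (full_inv _ _ _ (proj2_sig x)).
have [A [l1 [r1 [li ri]]]] : (forall x y z, mulN x (mulN y z) = mulN (mulN x y) z) /\
   (forall x, mulN oneN x = x) /\ (forall x, mulN x oneN = x) /\
   (forall x, mulN (invN x) x = oneN) /\ (forall x, mulN x (invN x) = oneN).
  by do !split; move=> *; apply: ext => /=; rewrite ?mulA; grp.
pose NG := Group N mulN oneN invN A l1 r1 li ri.
pose phi v (x : Gv v) : NG := exist _ _ (full_gen _ (fun _ => True) v x I).
have [|f [hf [ef _]]] := proj2 GP NG phi.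
  by split=> [v x y|u v uv x y]; apply: ext => /=; [apply: iota_hom | apply: iota_commute].
have [k [hk [ek uniq]]] := proj2 GP G iota (proj1 GP).
have e1 := uniq (fun g => g) (fun _ _ => eq_refl) (fun _ _ => eq_refl) g.
have e2 : proj1_sig (f g) = k g.
  by apply: (uniq (fun g => proj1_sig (f g))) => [x y|v x]; [rewrite hf | rewrite ef].
have -> : g = proj1_sig (f g) by rewrite e2 -e1.
exact: proj2_sig (f g).
Qed.
End FullSubgroups.

(** * Action of the graph product on reduced words *)

Record perm (X : Type) := Perm {
  pfun :> X -> X;
  pinv : X -> X;
  pfunK : forall x, pinv (pfun x) = x;
  pinvK : forall x, pfun (pinv x) = x }.
Arguments Perm {X}. Arguments pfun {X}. Arguments pinv {X}.

Lemma perm_ext {X : Type} (p q : perm X) : (forall x, p x = q x) -> p = q.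
Proof.
move=> e; have e' x : pinv p x = pinv q x.
  by rewrite -{1}(pinvK _ q x) -e pfunK.
case: p e e' => f g fK gK; case: q => f' g' fK' gK' /= e e'.
have E : f = f' by apply: functional_extensionality.
have E' : g = g' by apply: functional_extensionality.
by subst f' g'; congr Perm; apply: proof_irrelevance.
Qed.

Definition perm_mul {X : Type} (p q : perm X) : perm X.
Proof.
refine (Perm (fun x => p (q x)) (fun x => pinv q (pinv p x)) _ _) => x.
  by rewrite !pfunK.
by rewrite !pinvK.
Defined.

Definition perm_group (X : Type) : group.
Proof.
refine (Group (perm X) perm_mul (Perm (fun x => x) (fun x => x) (fun _ => eq_refl) (fun _ => eq_refl))
  (fun p => Perm (pinv p) p (pinvK _ p) (pfunK _ p)) _ _ _ _ _).
all: try by move=> *; apply: perm_ext.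
- by move=> p; apply: perm_ext => x /=; rewrite pfunK.
- by move=> p; apply: perm_ext => x /=; rewrite pinvK.
Defined.

Section Words.
Context {V : Type} {E : V -> V -> Prop} {Gv : V -> group} {G : group}
  {iota : forall v, Gv v -> G}.
Context (E_sym : forall u v, E u v -> E v u)
  (E_irr : forall v, ~ E v v) (GP : is_graph_product E Gv G iota).
Context (e : bool -> V) (e_neq : e true <> e false) (e_nonadj : ~ E (e true) (e false)).

Lemma e_inj s t : e s = e t -> s = t.
Proof. by case: s; case: t => // H; case: e_neq; rewrite H. Qed.

Lemma e_nadj s t : ~ E (e s) (e t).
Proof. by case: s; case: t => //; try exact: E_irr; move/E_sym. Qed.

(** * Conjugates of the two vertex groups, indexed by cosets of link subgroups *)

Definition coset (t : bool) (h : G) : G -> Prop :=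
  fun g => in_full iota (E (e t)) (mul (inv h) g).

Definition index : Type := bool * (G -> Prop).

(* The letter [((t, h L), m)], where [L] is the full subgroup on the link of [e t], stands
   for the element [m] of the conjugate of [G_(e t)] by [h], which depends only on [h L]. *)
Definition letter : Type := index * G.

Definition shift (g : G) (i : index) : index := (fst i, fun y => snd i (mul (inv g) y)).

Lemma shift_mul g h i : shift g (shift h i) = shift (mul g h) i.
Proof.
rewrite /shift /=; congr pair; apply: functional_extensionality => y.
by rewrite invMg mulA.
Qed.

Lemma shift_one i : shift one i = i.
Proof.
case: i => t S; rewrite /shift /=; congr pair; apply: functional_extensionality => y.
by grp.
Qed.

Lemma shift_coset g t h : shift g (t, coset t h) = (t, coset t (mul g h)).
Proof.
rewrite /shift /=; congr pair; apply: functional_extensionality => y.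
by rewrite /coset; congr in_full; grp.
Qed.

Lemma coset_mem t h : coset t h h.
Proof. by rewrite /coset mulVg; apply: full_one. Qed.

Lemma coset_eq t h h' : in_full iota (E (e t)) (mul (inv h) h') -> coset t h = coset t h'.
Proof.
move=> H; apply: functional_extensionality => g; apply: propositional_extensionality.
rewrite /coset; split=> H'.
  have -> : mul (inv h') g = mul (inv (mul (inv h) h')) (mul (inv h) g) by grp.
  by apply: full_mul => //; apply: full_inv.
have -> : mul (inv h) g = mul (mul (inv h) h') (mul (inv h') g) by grp.
exact: full_mul.
Qed.

Definition in_factor (i : index) (m : G) : Prop :=
  exists h (x : Gv (e (fst i))), snd i = coset (fst i) h /\
    m = mul h (mul (iota _ x) (inv h)).

Lemma in_factor_one i m : in_factor i m -> in_factor i one.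
Proof.
move=> [h [x [eS _]]]; exists h, one; split=> //.
by rewrite hom_one; [exact: (iota_hom GP) | grp].
Qed.

(** Two representatives of the coset differ by an element of the link subgroup, which centralizes
    the vertex group; so both describe the same conjugate. *)
Lemma in_factor_mul i m m' : in_factor i m -> in_factor i m' -> in_factor i (mul m m').
Proof.
case: i => t S [h [x [/= eS ->]]] [h' [x' [/= eS' ->]]].
exists h, (mul x x'); split=> //=.
have l : in_full iota (E (e t)) (mul (inv h) h').
  by have := coset_mem t h'; rewrite -eS' eS.
have c : mul (mul (inv h) h') (iota _ x') = mul (iota _ x') (mul (inv h) h').
  apply: (full_centralizes (E (e t)) (iota _ x') _ _ l) => v y ev.
  by symmetry; apply: (iota_commute GP).
have -> : mul h' (mul (iota _ x') (inv h')) = mul h (mul (iota _ x') (inv h)).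
  by apply: (mulgI (inv h)); rewrite mulKg !mulA c; grp.
by rewrite (iota_hom GP); grp.
Qed.

Lemma in_factor_shift g i m : in_factor i m ->
  in_factor (shift g i) (mul g (mul m (inv g))).
Proof.
case: i => t S [h [x [/= eS ->]]]; exists (mul g h), x; split; last by grp.
by rewrite eS; have := shift_coset g t h; rewrite /shift /= => -[].
Qed.

Lemma in_factor_base t (x : Gv (e t)) : in_factor (t, coset t one) (iota _ x).
Proof. by exists one, x; split=> //; grp. Qed.

(** * Reduced words and left multiplication by a factor *)

Fixpoint reduced (u : list letter) : Prop :=
  match u with
  | [] => True
  | l :: u' => in_factor (fst l) (snd l) /\ snd l <> one /\
      (match u' with l' :: _ => fst l <> fst l' | [] => True end) /\ reduced u'
  end.

Definition starts (i : index) (u : list letter) : Prop :=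
  match u with l :: _ => fst l = i | [] => False end.

(** A reduced word is [put i m w] for exactly one [m] in the factor and one [w] not starting in
    factor [i]; [head_of] and [tail_of] find them. On this decomposition [lmul] is van der Waerden's
    action of a free factor. *)
Definition head_of (i : index) (u : list letter) : G :=
  match u with
  | l :: _ => match excluded_middle_informative (fst l = i) with
              | left _ => snd l | right _ => one end
  | [] => one
  end.

Definition tail_of (i : index) (u : list letter) : list letter :=
  match u with
  | l :: u' => match excluded_middle_informative (fst l = i) with
              | left _ => u' | right _ => u end
  | [] => []
  end.

Definition put (i : index) (m : G) (u : list letter) : list letter :=
  match excluded_middle_informative (m = one) with
  | left _ => u
  | right _ => (i, m) :: u
  end.

Definition lmul (i : index) (m : G) (u : list letter) : list letter :=
  put i (mul m (head_of i u)) (tail_of i u).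

Local Ltac em := case: excluded_middle_informative.

Lemma put_one i u : put i one u = u.
Proof. by rewrite /put; em. Qed.

Lemma tail_reduced i u : reduced u -> reduced (tail_of i u) /\ ~ starts i (tail_of i u).
Proof.
case: u => [|l u] /=; first by split.
move=> [fl [nl [hd ru]]]; em => [E1|ne] /=; last by do !split.
split=> //; case: (u) hd => [_ []|l' u' ne E2].
by apply: ne; rewrite E2.
Qed.

Lemma put_head_tail i u : reduced u -> put i (head_of i u) (tail_of i u) = u.
Proof.
case: u => [_|[j m] u] /=; first by rewrite put_one.
move=> [fl [nl _]]; em => [E1|_]; last by rewrite put_one.
by rewrite /put; em => // _; rewrite E1.
Qed.

Lemma head_put i m u : ~ starts i u -> head_of i (put i m u) = m.
Proof.
rewrite /put; em => [->|ne] /=; last by em.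
by case: u => //= l u ns; em.
Qed.

Lemma tail_put i m u : ~ starts i u -> tail_of i (put i m u) = u.
Proof.
rewrite /put; em => [_|ne] /=; last by em.
by case: u => //= l u ns; em.
Qed.

Lemma put_reduced i m u : in_factor i m -> reduced u -> ~ starts i u -> reduced (put i m u).
Proof.
rewrite /put; em => //= ne fm ru ns; do !split=> //.
by case: u ns {ru} => //= l u ns E1; apply: ns.
Qed.

Lemma head_in_factor i m u : in_factor i m -> reduced u -> in_factor i (head_of i u).
Proof.
move=> fm; case: u => [_|l u] /=; first exact: in_factor_one fm.
by move=> [fl _]; em => [<-|_] //; apply: in_factor_one fm.
Qed.

Lemma lmul_reduced i m u : in_factor i m -> reduced u -> reduced (lmul i m u).
Proof.
move=> fm ru; have [rt nt] := tail_reduced i u ru.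
by apply: put_reduced => //; apply: in_factor_mul => //; apply: (head_in_factor _ m).
Qed.

Lemma lmul_mul i m m' u : reduced u -> lmul i m (lmul i m' u) = lmul i (mul m m') u.
Proof.
move=> ru; have [rt nt] := tail_reduced i u ru.
by rewrite {1}/lmul {2 3}/lmul head_put // tail_put // /lmul mulA.
Qed.

Lemma lmul_one i u : reduced u -> lmul i one u = u.
Proof. by move=> ru; rewrite /lmul mul1g put_head_tail. Qed.

Definition tags_all (t : bool) (u : list letter) : Prop :=
  forall l, In l u -> fst (fst l) = t.

Definition tag_starts (t : bool) (u : list letter) : Prop :=
  match u with l :: _ => fst (fst l) = t | [] => False end.

(** A letter of the other tag never merges with one of factor [i], so [u] stays untouched even when
    [p] is empty. *)
Lemma lmul_app i m p u : ~ tag_starts (fst i) u -> lmul i m (p ++ u) = lmul i m p ++ u.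
Proof.
have putE k q : put i k (q ++ u) = put i k q ++ u by rewrite /put; em.
move=> ns; rewrite /lmul -putE; case: p => [|l p] /=; last by em.
case: u ns {putE} => //= l u ns.
by em => // E1; case: ns; rewrite E1.
Qed.

Lemma lmul_tags i m p : tags_all (fst i) p -> tags_all (fst i) (lmul i m p).
Proof.
move=> tp; have tt : tags_all (fst i) (tail_of i p).
  case: p tp => //= l p tp; em => //= _ l' il; apply: tp; by right.
by rewrite /lmul /put; em => // _ l [<-|/tt].
Qed.

(** * Relabelling of words by conjugation *)

Definition conj_letter (g : G) (l : letter) : letter :=
  (shift g (fst l), mul g (mul (snd l) (inv g))).

Definition relabel (g : G) (u : list letter) : list letter := map (conj_letter g) u.

Lemma relabel_mul g h u : relabel g (relabel h u) = relabel (mul g h) u.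
Proof.
rewrite /relabel map_map; apply: map_ext => -[i m].
by rewrite /conj_letter /= shift_mul; grp.
Qed.

Lemma relabel_one u : relabel one u = u.
Proof.
rewrite /relabel -[RHS]map_id; apply: map_ext => -[i m].
by rewrite /conj_letter /= shift_one; grp.
Qed.

Lemma shift_inj g i j : shift g i = shift g j -> i = j.
Proof. by move=> H; rewrite -(shift_one i) -(shift_one j) -(mulVg _ g) -!shift_mul H. Qed.

Lemma conj_eq1 (g m : G) : mul g (mul m (inv g)) = one -> m = one.
Proof.
move=> H; apply: (mulIg (inv g)); apply: (mulgI g); rewrite H; by grp.
Qed.

Lemma relabel_reduced g u : reduced u -> reduced (relabel g u).
Proof.
elim: u => [//|[i m] u IH] /= [fl [nl [hd ru]]]; do !split.
- exact: in_factor_shift.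
- by move/conj_eq1.
- by case: (u) hd => //= l u' ne /shift_inj.
- exact: IH.
Qed.

Lemma relabel_lmul g i m u :
  relabel g (lmul i m u) = lmul (shift g i) (mul g (mul m (inv g))) (relabel g u).
Proof.
have putE k q : relabel g (put i k q) = put (shift g i) (mul g (mul k (inv g))) (relabel g q).
  rewrite /put; em => [->|ne]; em => //=.
    by case; grp.
  by move/conj_eq1.
rewrite /lmul putE; case: u => [|l u] /=; first by congr put; grp.
by em => [E1|ne]; em => //=; rewrite ?E1 //; [grp | move/shift_inj | grp].
Qed.

Lemma relabel_tag_starts t g u : tag_starts t (relabel g u) <-> tag_starts t u.
Proof. by case: u. Qed.

Definition eval (u : list letter) : G := fold_right (fun l g => mul (snd l) g) one u.

Lemma eval_lmul i m u : eval (lmul i m u) = mul m (eval u).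
Proof.
have putE k q : eval (put i k q) = mul k (eval q).
  by rewrite /put; em => [->|_] //=; grp.
rewrite /lmul putE; case: u => [|l u] /=; first by grp.
by em => [_|_] /=; grp.
Qed.

Lemma eval_relabel g u : eval (relabel g u) = mul g (mul (eval u) (inv g)).
Proof. by elim: u => [|l u IH] /=; rewrite ?IH; grp. Qed.

(** * The action of the vertex groups and its extension to the graph product *)

Definition base (t : bool) : index := (t, coset t one).

Definition gen_act (v : V) (x : Gv v) (u : list letter) : list letter :=
  match excluded_middle_informative (v = e true) with
  | left _ => lmul (base true) (iota v x) u
  | right _ =>
    match excluded_middle_informative (v = e false) with
    | left _ => lmul (base false) (iota v x) u
    | right _ => relabel (iota v x) u
    end
  end.

Definition others (v : V) : Prop := forall t, v <> e t.

Lemma gen_act_e t x u : gen_act (e t) x u = lmul (base t) (iota (e t) x) u.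
Proof. by case: t x => x; rewrite /gen_act; em => //; [move/e_inj | em]. Qed.

Lemma gen_act_others v x u : others v -> gen_act v x u = relabel (iota v x) u.
Proof. by move=> ov; rewrite /gen_act; em => [/ov|_] //; em => [/ov|_]. Qed.

Lemma othersP v : (exists t, v = e t) \/ others v.
Proof.
case: (classic (exists t, v = e t)); first by left.
by move=> n; right=> t E1; apply: n; exists t.
Qed.

Lemma gen_act_reduced v x u : reduced u -> reduced (gen_act v x u).
Proof.
move=> ru; have [[t E1]|ov] := othersP v.
  by subst v; rewrite gen_act_e; apply: lmul_reduced => //; apply: in_factor_base.
by rewrite gen_act_others //; apply: relabel_reduced.
Qed.

Lemma gen_act_mul v x y u : reduced u -> gen_act v (mul x y) u = gen_act v x (gen_act v y u).
Proof.
move=> ru; have [[t E1]|ov] := othersP v.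
  by subst v; rewrite !gen_act_e lmul_mul // (iota_hom GP).
by rewrite !gen_act_others // relabel_mul (iota_hom GP).
Qed.

Lemma gen_act_one v u : reduced u -> gen_act v one u = u.
Proof.
move=> ru; have i1 := hom_one _ (iota_hom GP v).
have [[t E1]|ov] := othersP v; first by subst v; rewrite gen_act_e i1 lmul_one.
by rewrite gen_act_others // i1 relabel_one.
Qed.

(** An element of the link subgroup fixes the base factor as an index and centralizes it, so
    relabelling commutes with left multiplication there. *)
Lemma relabel_lmul_link t v (x : Gv (e t)) (y : Gv v) u : E (e t) v ->
  relabel (iota v y) (lmul (base t) (iota (e t) x) u) =
  lmul (base t) (iota (e t) x) (relabel (iota v y) u).
Proof.
move=> tv; rewrite relabel_lmul /base shift_coset mulA -(iota_commute GP) // -mulA mulgV !mulg1.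
have <- // : coset t one = coset t (iota v y).
by apply: coset_eq; rewrite invg1 mul1g; apply: full_gen.
Qed.

Lemma gen_act_commute v w x y u : E v w -> reduced u ->
  gen_act v x (gen_act w y u) = gen_act w y (gen_act v x u).
Proof.
move=> vw ru.
have [[t E1]|ov] := othersP v; have [[s E2]|ow] := othersP w.
- by subst v w; case: (e_nadj t s).
- by subst v; rewrite !gen_act_e !(gen_act_others w) // relabel_lmul_link.
- by subst w; rewrite !gen_act_e !(gen_act_others v) // relabel_lmul_link //; apply: E_sym.
- by rewrite !gen_act_others // !relabel_mul (iota_commute GP).
Qed.

Definition word : Type := {u : list letter | reduced u}.

Lemma word_ext (u v : word) : proj1_sig u = proj1_sig v -> u = v.
Proof. by apply: eq_sig_hprop => ? ? ?; apply: proof_irrelevance. Qed.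

Definition gen_word v (x : Gv v) (u : word) : word :=
  exist _ (gen_act v x (proj1_sig u)) (gen_act_reduced v x _ (proj2_sig u)).

Lemma gen_wordK v (x y : Gv v) u : mul x y = one -> gen_word v x (gen_word v y u) = u.
Proof.
move=> xy; apply: word_ext => /=; have ru := proj2_sig u.
by rewrite -gen_act_mul // xy gen_act_one.
Qed.

Definition gen_perm v (x : Gv v) : perm_group word :=
  Perm (gen_word v x) (gen_word v (inv x))
    (fun u => gen_wordK v (inv x) x u (mulVg _ x)) (fun u => gen_wordK v x (inv x) u (mulgV _ x)).

Lemma word_action_exists : exists act : G -> word -> word,
  (forall u, act one u = u) /\ (forall g h u, act (mul g h) u = act g (act h u)) /\
  (forall v x u, proj1_sig (act (iota v x) u) = gen_act v x (proj1_sig u)).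
Proof.
have [|f [hf [ef _]]] := proj2 GP (perm_group word) gen_perm.
  split=> [v x y|v w vw x y]; apply: perm_ext => u; apply: word_ext => /=.
    by apply: gen_act_mul; apply: proj2_sig.
  by apply: gen_act_commute => //; apply: proj2_sig.
exists (fun g => pfun (f g)); split; last split.
- by rewrite (hom_one _ hf).
- by move=> g h u; rewrite hf.
- by move=> v x u; rewrite ef.
Qed.

Definition word_act : G -> word -> word :=
  proj1_sig (constructive_indefinite_description _ word_action_exists).

Lemma word_actP : (forall u, word_act one u = u) /\
  (forall g h u, word_act (mul g h) u = word_act g (word_act h u)) /\
  (forall v x u, proj1_sig (word_act (iota v x) u) = gen_act v x (proj1_sig u)).
Proof. by rewrite /word_act; case: constructive_indefinite_description. Qed.

Lemma word_act_gen v x g u : proj1_sig (word_act (mul (iota v x) g) u) =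
  gen_act v x (proj1_sig (word_act g u)).
Proof. by have [_ [aM ag]] := word_actP; rewrite aM ag. Qed.

Definition empty_word : word := exist _ [] I.

(** * Words of elements of the two amalgamated subgroups *)

Definition side (t : bool) (g : G) : Prop := in_full iota (fun v => v <> e (negb t)) g.

Lemma side_group t : side t one /\ (forall g h, side t g -> side t h -> side t (mul g h)) /\
  (forall g, side t g -> side t (inv g)).
Proof.
split; first exact: full_one.
by split=> [g h|g]; [exact: full_mul | exact: full_inv].
Qed.

Lemma side_generated (P : G -> Prop) : P one ->
  (forall t g h, side t g -> P h -> P (mul g h)) -> forall g, P g.
Proof.
move=> P1 PS g.
elim/(full_left_ind GP (fun _ => True)): g / (graph_product_generated GP g) => [//|v x g _ _ Pg].
case: (classic (v = e false)) => [E1|n].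
  by apply: (PS false) => //; apply: full_gen; rewrite E1 => /e_inj.
by apply: (PS true) => //; apply: full_gen.
Qed.

Lemma others_side t g : in_full iota others g -> side t g.
Proof. by apply: full_mono => v ov; apply: ov. Qed.

Lemma side_inter t g : side t g -> side (negb t) g -> in_full iota others g.
Proof.
move=> h1 h2; apply: full_mono (full_inter GP _ _ g h1 h2) => v [n1 n2] s.
by case: t s n1 n2 {h1 h2} => -[].
Qed.

Definition rho : G -> G := retr GP others.

Lemma rho_full g : in_full iota others (rho g).
Proof.
have := retr_full GP others _ g (graph_product_generated GP g).
by apply: full_mono => v [].
Qed.

Lemma rho_gen v x g : rho (mul (iota v x) g) = mul (cut (iota := iota) others v x) (rho g).
Proof. by rewrite /rho (retr_hom GP) (retr_gen GP). Qed.

Lemma cut_e t x : cut (iota := iota) others (e t) x = one.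
Proof. by rewrite /cut; em => // /(_ t). Qed.

Lemma cut_others v x : others v -> cut (iota := iota) others v x = iota v x.
Proof. by rewrite /cut; em. Qed.

(** At the empty word this says that [g] is the value of its word times [rho g], so the word and the
    retraction recover [g]. *)
Lemma eval_act g u : eval (proj1_sig (word_act g u)) =
  mul g (mul (eval (proj1_sig u)) (inv (rho g))).
Proof.
have [a1 _] := word_actP.
elim/(full_left_ind GP (fun _ => True)): g / (graph_product_generated GP g) => [|v x g _ _ IH].
  by rewrite a1 /rho hom_one; [exact: retr_hom | grp].
rewrite word_act_gen rho_gen; have [[t E1]|ov] := othersP v.
  by subst v; rewrite gen_act_e eval_lmul IH cut_e; grp.
by rewrite gen_act_others // eval_relabel IH cut_others //; grp.
Qed.

Lemma act_others g u : in_full iota others g ->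
  proj1_sig (word_act g u) = relabel g (proj1_sig u).
Proof.
have [a1 _] := word_actP.
elim/(full_left_ind GP others): g / => [|v x g ov _ IH]; first by rewrite a1 relabel_one.
by rewrite word_act_gen gen_act_others // IH relabel_mul.
Qed.

(** An element of [side t] rewrites only the maximal initial run of letters of tag [t]; on the rest
    it acts through its image under [rho]. *)
Lemma act_split t g u p v : side t g -> proj1_sig u = p ++ v -> tags_all t p ->
  ~ tag_starts t v ->
  exists p', proj1_sig (word_act g u) = p' ++ relabel (rho g) v /\ tags_all t p'.
Proof.
move=> sg eu tp tv; have [a1 _] := word_actP.
elim/(full_left_ind GP (fun v => v <> e (negb t))): g / sg => [|w x g nw _ [p' [IH tp']]].
  by exists p; rewrite a1 /rho hom_one ?relabel_one //; apply: retr_hom.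
rewrite word_act_gen rho_gen IH; have [[s E1]|ow] := othersP w.
  subst w; have Es : s = t by case: s t nw {eu tp tv IH tp'} x => -[].
  subst s; exists (lmul (base t) (iota _ x) p').
  by rewrite gen_act_e lmul_app ?cut_e ?mul1g ?relabel_tag_starts //; split=> //; apply: lmul_tags.
exists (relabel (iota w x) p').
rewrite gen_act_others // cut_others // -relabel_mul /relabel map_app; split=> //.
by move=> l /in_map_iff [l' [<- /tp']].
Qed.

Lemma act_side_empty t g : side t g -> tags_all t (proj1_sig (word_act g empty_word)).
Proof.
move=> sg; have [//|//|//|p [-> tp]] := act_split t g empty_word [] [] sg.
by rewrite app_nil_r.
Qed.

(* An element of [side t] whose action creates no letter equals its image under [rho]. *)
Lemma act_creates_letter t g u : side t g -> ~ side (negb t) g ->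
  ~ tag_starts t (proj1_sig u) ->
  exists l p, proj1_sig (word_act g u) = l :: p ++ relabel (rho g) (proj1_sig u) /\
    tags_all t (l :: p).
Proof.
move=> sg ng tu; have [//|//|//|p [E1 tp]] := act_split t g u [] (proj1_sig u) sg.
case: p E1 tp => [|l p] E1 tp; last by exists l, p.
case: ng; have := eval_act g u; rewrite E1 /= eval_relabel => H.
have -> : g = rho g by apply: (mulIg _ _ _ (eq_sym H)).
by apply: others_side; apply: rho_full.
Qed.

(** Alternating products in the amalgam; the two booleans record the sides of the first and the last
    factor. *)
Inductive altprod (P : bool -> G -> Prop) : bool -> bool -> G -> Prop :=
| altprod_one t s : P t s -> ~ P (negb t) s -> altprod P t t s
| altprod_cons t r s g : P t s -> ~ P (negb t) s -> altprod P (negb t) r g ->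
    altprod P t r (mul s g).

(** The last factor creates a letter of tag [r] on the empty word; every earlier factor prepends
    letters of its own tag and merely relabels what is there. *)
Lemma altprod_word t r g : altprod side t r g ->
  tag_starts t (proj1_sig (word_act g empty_word)) /\
  exists l, In l (proj1_sig (word_act g empty_word)) /\ fst (fst l) = r.
Proof.
have [_ [aM _]] := word_actP.
elim=> {t r g} [t s st ns|t r s g st ns _ [IH1 [l [IH2 IH3]]]].
  have [//|l [p [-> tp]]] := act_creates_letter t s empty_word st ns.
  split; first by apply: tp; left.
  by exists l; split; [left | apply: tp; left].
have [|l' [p [E1 tp]]] := act_creates_letter t s (word_act g empty_word) st ns.
  by case: (proj1_sig (word_act g empty_word)) IH1 => //= l1 u1 -> ; case: (t).
rewrite aM E1; split; first by apply: tp; left.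
exists (conj_letter (rho s) l); split=> //.
by right; apply: in_or_app; right; apply: in_map.
Qed.

Lemma altprod_side t r g : altprod side t r g -> ~ side (negb r) g.
Proof.
move=> /altprod_word [_ [l [il el]]] /act_side_empty /(_ l il).
by rewrite el; case: (r).
Qed.

Lemma side_stabilizer t s : side t s -> ~ side (negb t) s -> exists h, forall g,
  side t g -> side (negb t) g -> side (negb t) (mul (inv s) (mul g s)) ->
  in_full iota (E (e t)) (mul (inv h) (mul g h)).
Proof.
move=> st ns; have [_ [aM _]] := word_actP.
have [//|l [p [E1 tp]]] := act_creates_letter t s empty_word st ns.
have := proj2_sig (word_act s empty_word); rewrite E1 /= => -[[h [x [eS _]]] _].
have [_ [sM sV]] := side_group t.
exists h => g gt gn gs.
have go := side_inter t g gt gn.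
have gso : in_full iota others (mul (inv s) (mul g s)).
  by apply: (side_inter t) => //; apply: (sM _ _); [apply: sV | apply: (sM _ _)].
(* The conjugate of [g] by [s] lies in the full subgroup on [others] and so fixes the empty word;
   hence [g], which acts by relabelling, fixes the word of [s]. *)
have : relabel g (proj1_sig (word_act s empty_word)) = proj1_sig (word_act s empty_word).
  rewrite -(act_others g) // -aM -{1}(mulVKg s (mul g s)) aM.
  have -> // : word_act (mul (inv s) (mul g s)) empty_word = empty_word.
  by apply: word_ext; rewrite act_others.
rewrite E1 /= => -[E2 _].
have : snd (fst (conj_letter g l)) (mul g h) = snd (fst l) (mul g h) by rewrite E2.
by rewrite /= eS /coset mulKg mulVg (tp l (or_introl eq_refl)) => <-; apply: full_one.
Qed.
End Words.

(** * Acylindrical actions on trees *)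

Lemma NoDup_map_inj {A B : Type} (f : A -> B) (l : list A) :
  (forall x y, In x l -> In y l -> f x = f y -> x = y) -> NoDup l -> NoDup (map f l).
Proof.
move=> inj nd; elim: nd inj => [|x l' nx _ IH] inj; first exact: NoDup_nil.
apply: NoDup_cons.
  move=> /in_map_iff [y [E il]]; apply: nx.
  by rewrite -(inj y x) //; [right | left].
by apply: IH => y z iy iz; apply: inj; right.
Qed.

Lemma infinite_NoDup {G : group} (P : G -> Prop) : ~ finite_subgroup P ->
  forall n, exists l, NoDup l /\ length l = n /\ forall x, In x l -> P x.
Proof.
move=> inf; elim=> [|n [l [nd [len Pl]]]].
  by exists []; split; [exact: NoDup_nil | split].
have [x [Px nx]] : exists x, P x /\ ~ In x l.
  apply: NNPP => H; apply: inf; exists l => x Px; apply: NNPP => nx.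
  by apply: H; exists x.
exists (x :: l); split; first exact: NoDup_cons.
by split=> [|y [<-|/Pl]] //=; rewrite len.
Qed.

Section TreeAction.
Context {G : group} {T : Type} {adj : T -> T -> Prop} {act : G -> T -> T}.
Context (tree : is_tree adj) (action : is_tree_action G adj act).
Context (d : T -> T -> nat) (tm : tree_metric d) (gm : graph_metric adj d).

Let act1 : forall x, act one x = x := proj1 action.
Let actM : forall g h x, act (mul g h) x = act g (act h x) := proj1 (proj2 action).
Let iso := act_isometry adj d gm G act action.

Lemma not_hyperbolic_of_infinite_centralizer (L : G -> Prop) g :
  acylindrical G adj act -> ~ finite_subgroup L ->
  (forall l, L l -> mul l g = mul g l) ->
  (forall l l' k k', L l -> L l' -> mul l (gpow g k) = mul l' (gpow g k') -> l = l') ->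
  ~ hyperbolic d act g.
Proof.
move=> acyl inf C inj [x lt].
have [R [N H]] := acyl (d x (act g x)).
pose gn := gpow g (Z.of_nat (S R)).
have far := hyperbolic_displacement d tm act act1 actM iso g x lt R.
have [ls [nd [len Lls]]] := infinite_NoDup L inf (S N).
pose f l := epsilon (inhabits 0%Z) (fun k => d x (act (mul l (gpow g k)) x) <= d x (act g x)).
have Hf l : L l -> d x (act (mul l (gpow g (f l))) x) <= d x (act g x).
  move=> Ll; apply: (epsilon_spec (inhabits 0%Z)
    (fun k => d x (act (mul l (gpow g k)) x) <= d x (act g x))).
  have C' := commute_inv l g (C l Ll).
  have [k le] := commuting_near_orbit d tm act act1 actM iso g (inv l) x C' lt.
  by exists k; move: le; rewrite -(iso l) -!actM mulgV act1.
suff : S N <= N by lia.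
rewrite -{1}len -(length_map (fun l => mul l (gpow g (f l))) ls).
apply: (H x (act gn x)).
- by apply/(dist_geE adj d gm); rewrite /gn; lia.
- by apply: NoDup_map_inj => // l l' /Lls Ll /Lls Ll'; apply: inj.
- move=> h /in_map_iff [l [<- /Lls Ll]].
  split; apply/(dist_leE adj d gm); first exact: Hf.
  have -> : act (mul l (gpow g (f l))) (act gn x) = act gn (act (mul l (gpow g (f l))) x).
    rewrite -!actM; congr act.
    have Cg : mul gn l = mul l gn by apply: gpow_commute; symmetry; apply: C.
    by rewrite mulA Cg -!mulA /gn -!gpow_add Z.add_comm.
  by rewrite iso; apply: Hf.
Qed.

(** Powers of the product split as powers of [g] times powers of [h], so orbits are bounded by the
    distances to [p] and [q], while a hyperbolic element has linearly growing displacement. *)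
Lemma hyperbolic_commuting_product g h p q : mul g h = mul h g ->
  Fix act g p -> Fix act h q -> ~ hyperbolic d act (mul g h).
Proof.
move=> C gp hq [x lt].
have := hyperbolic_displacement d tm act act1 actM iso _ x lt (2 * d x p + 2 * d x q).
rewrite gpow_mul_commute // actM.
set n := Z.of_nat _.
have gnp := Fix_gpow act act1 actM g p n gp.
have hnq := Fix_gpow act act1 actM h q n hq.
have far k r z : Fix act k r -> d z (act k z) <= 2 * d z r.
  move=> kr; have := tm_tri d tm z r (act k z).
  by rewrite -{2}kr iso (tm_sym d tm r z); lia.
have := tm_tri d tm x (act (gpow g n) x) (act (gpow g n) (act (gpow h n) x)).
rewrite iso.
by have := far _ _ x gnp; have := far _ _ x hnq; lia.
Qed.

(* Infinitely many elements fixing a common point have a bounded common fixed set, by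
   acylindricity with [eps = 0]; this makes [helly_bounded] applicable. *)
Lemma common_fixed_point (Q : G -> Prop) : acylindrical G adj act ->
  (forall g h, Q g -> Q h -> exists x, Fix act g x /\ Fix act h x) ->
  exists x, forall g, Q g -> Fix act g x.
Proof.
move=> acyl QQ; have [[o] _] := tree.
have cF g : convex d (Fix act g) by apply: Fix_convex.
have list_fix l : (forall g, In g l -> Q g) -> exists x, all_of (Fix act) l x.
{ move=> Ql; have [||||x [_ H]] := helly_list d tm (Fix act) cF (fun _ => True) l.
  - by [].
  - by exists o.
  - by move=> s /Ql Qs; have [x [Fx _]] := QQ s s Qs Qs; exists x.
  - by move=> s t /Ql Qs /Ql Qt; apply: QQ.
  - by exists x. }
case: (classic (finite_subgroup Q)) => [[l lQ]|inf].
  have [x Hx] : exists x, all_of (fun g y => Q g -> Fix act g y) l x; last first.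
    by exists x => g Qg; apply: Hx => //; apply: lQ.
  (* The list [l] may contain elements outside [Q]; [l'] keeps those in [Q]. *)
  have [l' Hl'] : exists l', forall g, In g l' <-> In g l /\ Q g.
    elim: (l) => [|g l0 [l1 H1]]; first by exists [] => g; split=> // -[].
    case: (classic (Q g)) => [Qg|nQ].
      exists (g :: l1) => h; split=> [[<-|/H1 [? ?]]|[[<-|?] ?]];
        [by split; [left|] | by split; [right|] | by left | by right; apply/H1].
    exists l1 => h; split=> [/H1 [? ?]|[[E|?] Qh]]; [by split; [right|] | | by apply/H1].
    by case: nQ; rewrite E.
  have [|x Hx] := list_fix l'; first by move=> g /Hl' [].
  by exists x => g gl Qg; apply: Hx; apply/Hl'.
have [R [N H]] := acyl 0.
have [l [nd [len Ql]]] := infinite_NoDup Q inf (S N).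
have [p Hp] := list_fix l Ql.
apply: (helly_bounded d tm (Fix act) cF Q l p R QQ Ql) => x Hx.
case: (le_lt_dec (d p x) R) => // lt.
suff : S N <= N by lia.
rewrite -{1}len; apply: (H p x _ l nd).
  by apply/(dist_geE adj d gm); lia.
by move=> g gl; split; apply/(dist_leE adj d gm); rewrite ?(Hp g gl) ?(Hx g gl) (tm_refl d tm).
Qed.

Lemma loxodromic_unbounded g : loxodromic G adj act g ->
  exists x, forall B, exists n : nat, forall k, (Z.of_nat n <= Z.abs k)%Z ->
    B <= d x (act (gpow g k) x).
Proof.
move=> [x [lam [c [l1 [c0 H]]]]]; exists x => B.
(* For exponents of absolute value at least this [n], the lower quasi-isometry bound is at least
   [B]. *)
have [n Hn] := INR_unbounded (lam * (INR B + c)).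
exists n => k Hk.
have [lo _] := H 0%Z k _ (proj2 (is_distE adj d gm _ _ _) eq_refl).
have Ek : (INR n <= IZR (Z.abs (0 - k)))%R.
  by rewrite INR_IZR_INZ; apply: IZR_le; lia.
rewrite act1 in lo; apply: INR_le.
have : (/ lam * (lam * (INR B + c)) <= / lam * IZR (Z.abs (0 - k)))%R.
  apply: Rmult_le_compat_l; last by lra.
  by apply: Rlt_le; apply: Rinv_0_lt_compat; lra.
by rewrite -Rmult_assoc Rinv_l; lra.
Qed.

Lemma loxodromic_not_elliptic g p : loxodromic G adj act g -> ~ Fix act g p.
Proof.
move=> /loxodromic_unbounded [x H] gp.
have [n Hn] := H (S (2 * d x p)).
have := Hn (Z.of_nat n) ltac:(lia).
have F := Fix_gpow act act1 actM g p (Z.of_nat n) gp.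
have := tm_tri d tm x p (act (gpow g (Z.of_nat n)) x).
by rewrite -{2}F iso (tm_sym d tm p x); lia.
Qed.

(** Along multiples of a common power the two orbits coincide, so their mutual distance is 0 while
    the distance from the base point is unbounded. *)
Lemma independent_no_common_power g h m n : loxodromic G adj act g ->
  independent G adj act g h -> m <> 0%Z -> n <> 0%Z -> gpow g m <> gpow h n.
Proof.
move=> /loxodromic_unbounded [x H] ind m0 n0 E.
have sgn (z : Z) : exists s, forall i : nat, sgnZ s (Z.to_nat (Z.abs z) * i) = (z * Z.of_nat i)%Z.
  case: (Z_lt_le_dec z 0) => lt; [exists false | exists true] => i /=; lia.
have [s Hs] := sgn m; have [t Ht] := sgn n.
have [B HB] := ind x s t.
have [i Hi] := H (S B).
have := HB (Z.to_nat (Z.abs m) * i) (Z.to_nat (Z.abs n) * i) _ _ _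
  (proj2 (is_distE adj d gm _ _ _) eq_refl) (proj2 (is_distE adj d gm _ _ _) eq_refl)
  (proj2 (is_distE adj d gm _ _ _) eq_refl).
have := Hi (m * Z.of_nat i)%Z ltac:(nia).
by rewrite Hs Ht !gpow_mul -E (tm_refl d tm); lia.
Qed.

Lemma not_virtually_cyclic : non_elementary G adj act -> ~ virtually_cyclic G.
Proof.
move=> [f [_ [lox ind]]] [g [s Hs]].
(* Pigeonhole: among more powers of [f i] than representatives in [s], two share a representative,
   and their quotient is a power of [g]. *)
have pow i : exists m n, m <> 0%Z /\ gpow (f i) m = gpow g n.
{ pose y k := epsilon (inhabits one) (fun y => exists n, In y s /\ gpow (f i) k = mul y (gpow g n)).
  have Hy k : exists n, In (y k) s /\ gpow (f i) k = mul (y k) (gpow g n).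
    apply: (epsilon_spec (inhabits one) (fun y => exists n, In y s /\ gpow (f i) k = mul y (gpow g n))).
    by have [z [n H]] := Hs (gpow (f i) k); exists z, n.
  apply: NNPP => N.
  suff : length (map (fun k => y (Z.of_nat k)) (seq 0 (S (length s)))) <= length s.
    by rewrite length_map length_seq; lia.
  apply: NoDup_incl_length; last by move=> z /in_map_iff [k [<- _]]; have [n []] := Hy (Z.of_nat k).
  apply: NoDup_map_inj (seq_NoDup _ _) => k l _ _ Ey.
  apply: NNPP => kl; apply: N.
  have [n [_ En]] := Hy (Z.of_nat k); have [n' [_ En']] := Hy (Z.of_nat l).
  exists (- Z.of_nat k + Z.of_nat l)%Z, (- n + n')%Z; split; first lia.
  by rewrite !gpow_add !gpow_opp En En' Ey; grp. }
have [m [n [m0 E0]]] := pow 0; have [m' [n' [m0' E1]]] := pow 1.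
(* Loxodromic elements have infinite order, so the exponents of [g] are non-zero and [f 0], [f 1]
   acquire a common power with non-zero exponents. *)
have nz i j k : j <> 0%Z -> gpow (f i) j = gpow g k -> k <> 0%Z.
  move=> j0 E2 k0; subst k.
  have [x H] := loxodromic_unbounded (f i) (lox i).
  have [r Hr] := H 1.
  have := Hr (j * Z.of_nat r)%Z ltac:(nia); rewrite gpow_mul E2 -gpow_mul act1 (tm_refl d tm).
  by lia.
have n0 := nz _ _ _ m0 E0; have n0' := nz _ _ _ m0' E1.
apply: (independent_no_common_power (f 0) (f 1) (m * n') (m' * n)) => //; try lia.
  by apply: ind.
by rewrite !gpow_mul E0 E1 -!gpow_mul Z.mul_comm.
Qed.
End TreeAction.

(** * Existence of a separated pair *)

Lemma dist_ge2 {V : Type} (E : V -> V -> Prop) a b :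
  dist_ge E a b 2 <-> a <> b /\ ~ E a b.
Proof.
split=> [H|[ne nE] [|c [|c' l]] /=].
- split=> [ab|ab]; first by have := H [] ab => /=; lia.
  by have := H [b] (conj ab eq_refl) => /=; lia.
- by move=> ab; case: ne.
- by move=> [ac cb]; case: nE; rewrite -cb.
- by move=> _; lia.
Qed.

Section Forward.
Context {V : Type} {E : V -> V -> Prop} {Gv : V -> group} {G : group}
  {iota : forall v, Gv v -> G}.
Context (E_sym : forall u v, E u v -> E v u)
  (E_irr : forall v, ~ E v v) (GP : is_graph_product E Gv G iota)
  (nontrivial : forall v, exists x : Gv v, x <> one).

(** Positive powers of a product of non-trivial elements of the two vertex groups are alternating
    products, hence non-trivial. *)
Lemma pair_infinite a b : a <> b -> ~ E a b ->
  ~ finite_subgroup (in_full iota (fun v => v = a \/ v = b)).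
Proof.
move=> ab nE; pose e (t : bool) := if t then a else b.
have [x nx] := nontrivial a; have [y ny] := nontrivial b.
set g := mul (iota a x) (iota b y).
have alt n : altprod (side (iota := iota) e) true false (gpow g (Z.of_nat (S n))).
{ have sx : side (iota := iota) e true (iota a x) by apply: full_gen.
  have sy : side (iota := iota) e false (iota b y) by apply: full_gen => E1; apply: ab.
  have nsx : ~ side (iota := iota) e (negb true) (iota a x).
    by apply: (iota_not_full E_irr GP) => // H; apply: H.
  have nsy : ~ side (iota := iota) e (negb false) (iota b y).
    by apply: (iota_not_full E_irr GP) => // H; apply: H.
  elim: n => [|n IH].
    by rewrite gpow1; apply: altprod_cons => //; apply: altprod_one.
  rewrite Nat2Z.inj_succ gpow_succ /g -mulA; apply: altprod_cons => //.
  exact: altprod_cons. }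
have pow1 n : gpow g (Z.of_nat (S n)) <> one.
  move=> E1; have := altprod_side E_sym E_irr GP e ab nE _ _ _ (alt n).
  by rewrite E1; apply; apply: full_one.
have neq m n : m < n -> gpow g (Z.of_nat m) <> gpow g (Z.of_nat n).
  move=> lt E1; apply: (pow1 (n - m - 1)).
  have -> : Z.of_nat (S (n - m - 1)) = (Z.of_nat n + - Z.of_nat m)%Z by lia.
  by rewrite gpow_add gpow_opp E1 mulgV.
move=> [l Hl].
suff : length (map (fun n => gpow g (Z.of_nat n)) (seq 0 (S (length l)))) <= length l.
  by rewrite length_map length_seq; lia.
apply: NoDup_incl_length.
  apply: NoDup_map_inj (seq_NoDup _ _) => m n _ _ E1.
  by case: (Nat.lt_trichotomy m n) => [/neq|[|/neq]] //; rewrite E1.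
move=> z /in_map_iff [n [<- _]]; apply: Hl.
elim: n => [|n IH]; first exact: full_one.
rewrite Nat2Z.inj_succ gpow_succ; apply: full_mul => //.
by apply: full_mul; apply: full_gen; auto.
Qed.

Context {T : Type} {adj : T -> T -> Prop} {act : G -> T -> T}.
Context (tree : is_tree adj) (action : is_tree_action G adj act)
  (acyl : acylindrical G adj act).

Lemma commuting_full_not_hyperbolic (d : T -> T -> nat) (A B : V -> Prop) g :
  tree_metric d -> graph_metric adj d ->
  (forall u v, A u -> B v -> E u v) -> in_full iota A g ->
  ~ finite_subgroup (in_full iota B) -> ~ hyperbolic d act g.
Proof.
move=> tm gm AB Ag inf.
apply: (not_hyperbolic_of_infinite_centralizer action d tm gm (in_full iota B) g acyl inf).
  by move=> l Bl; symmetry; apply: (full_commute GP A B).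
(* The retraction onto [A] kills [l] and fixes the power of [g]; so the product of the two
   determines the power, and then [l]. *)
have h := retr_hom GP A.
have BA v : B v -> ~ A v by move=> Bv Av; apply: (E_irr v); apply: AB.
move=> l l' k k' Bl Bl' E1.
have : retr GP A (mul l (gpow g k)) = retr GP A (mul l' (gpow g k')) by rewrite E1.
rewrite !h (retr_trivial GP A B l BA Bl) (retr_trivial GP A B l' BA Bl') !(hom_gpow _ _ _ h) retr_id // !mul1g => E2.
by apply: (mulIg (gpow g k)); rewrite E1 E2.
Qed.

Lemma separated_exists : diam_ge2 E -> non_elementary G adj act ->
  exists a b, separated E iota a b.
Proof.
move=> [a0 [b0 ab0]] [f [_ [lox _]]]; apply: NNPP => nsep.
have inf a b : a <> b -> ~ E a b -> ~ finite_subgroup (in_full iota (link2 E a b)).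
  by move=> ne nE fin; apply: nsep; exists a, b; split=> //; apply/dist_ge2.
have [d [tm gm]] := is_tree_metric adj tree.
have iso := act_isometry adj d gm G act action.
have noinv := act_no_inversion adj d gm G act action.
have act1 := proj1 action; have actM := proj1 (proj2 action).
have [[o] _] := tree.
have fixed := fixed_of_not_hyperbolic d tm act iso o noinv.
have nh_pair a b g : a <> b -> ~ E a b -> in_full iota (fun v => v = a \/ v = b) g ->
    ~ hyperbolic d act g.
  move=> ne nE fg; apply: (commuting_full_not_hyperbolic d _ (link2 E a b) g tm gm _ fg).
    by move=> u v [->|->] [].
  exact: inf.
have nh_gen v (x : Gv v) : ~ hyperbolic d act (iota v x).
(* Either [v] has a non-neighbour [w], or it is a cone vertex; then its group commutes with the
   infinite full subgroup on the non-adjacent pair [a0], [b0]. *)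
{ case: (classic (exists w, v <> w /\ ~ E v w)) => [[w [ne nE]]|cone].
    by apply: (nh_pair v w) => //; apply: full_gen; left.
  have adjv w : v <> w -> E v w.
    by move=> ne; apply: NNPP => nE; apply: cone; exists w.
  have [ne nE] := proj1 (dist_ge2 E a0 b0) ab0.
  apply: (commuting_full_not_hyperbolic d (fun u => u = v) (fun u => u = a0 \/ u = b0)) => //.
  - have va : v <> a0 by move=> E1; apply: nE; rewrite -E1; apply: adjv; rewrite E1.
    have vb : v <> b0 by move=> E1; apply: nE; apply: E_sym; rewrite -E1; apply: adjv; rewrite E1; auto.
    by move=> u w -> [->|->]; apply: adjv.
  - exact: full_gen.
  - exact: pair_infinite. }
pose Q g := exists v (x : Gv v), g = iota v x.
have [p Hp] : exists p, forall g, Q g -> Fix act g p.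
{ apply: (common_fixed_point tree action d tm gm Q acyl) => g h [v [x ->]] [w [y ->]].
  apply: (Fix_meet d tm act actM iso).
  - by apply: fixed.
  - by apply: fixed.
  (* The product is not hyperbolic: it lies in one vertex group, is a product of commuting elliptic
     elements, or lies in the full subgroup on a non-adjacent pair. *)
  - case: (classic (v = w)) => [E1|ne].
      by subst w; rewrite -(iota_hom GP).
    case: (classic (E v w)) => [vw|nE].
      have [q Hq] := fixed _ (nh_gen v x); have [r Hr] := fixed _ (nh_gen w y).
      apply: (hyperbolic_commuting_product action d tm gm _ _ q r) => //.
      exact: (iota_commute GP).
    by apply: (nh_pair v w) => //; apply: full_mul; apply: full_gen; auto. }
apply: (loxodromic_not_elliptic action d tm gm (f 0) p (lox 0)).
elim/(full_left_ind GP (fun _ => True)): (f 0) / (graph_product_generated GP (f 0)) => [|v x g _ _ Pg].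
  exact: act1.
by rewrite /Fix actM Pg; apply: Hp; exists v, x.
Qed.
End Forward.

(** * Criteria for acylindricity and for independence *)

Lemma length_le_fibers {A : Type} (f : A -> nat) (M K : nat) (l : list A) : NoDup l ->
  (forall x, In x l -> f x < M) ->
  (forall m l', NoDup l' -> (forall x, In x l' -> In x l /\ f x = m) -> length l' <= K) ->
  length l <= M * K.
Proof.
elim: M l => [|M IH] l nd lt fib.
  by case: l lt {nd fib} => [|x l] lt /=; [lia | have := lt x (or_introl eq_refl); lia].
have E : length l = length (filter (fun x => f x <? M) l) +
                    length (filter (fun x => negb (f x <? M)) l).
  by elim: (l) => //= x l' ->; case: (f x <? M) => /=; lia.
have in_lt x : In x (filter (fun x => f x <? M) l) -> In x l /\ f x < M.
  by move=> /filter_In [il /Nat.ltb_lt].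
have : length (filter (fun x => f x <? M) l) <= M * K.
  apply: IH; first exact: NoDup_filter.
    by move=> x /in_lt [].
  move=> m l' nd' H; apply: (fib m) => // x xl; have [/in_lt [il _] e] := H x xl.
  by split.
have : length (filter (fun x => negb (f x <? M)) l) <= K.
  apply: (fib M); first exact: NoDup_filter.
  move=> x /filter_In [il /negb_true_iff /Nat.ltb_ge ge]; split=> //.
  by have := lt x il; lia.
by rewrite E /=; lia.
Qed.

Section Criteria.
Context {G : group} {T : Type} {adj : T -> T -> Prop} {act : G -> T -> T}.
Context (action : is_tree_action G adj act).
Context (d : T -> T -> nat) (tm : tree_metric d) (gm : graph_metric adj d).

Let act1 : forall x, act one x = x := proj1 action.
Let actM : forall g h x, act (mul g h) x = act g (act h x) := proj1 (proj2 action).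
Let iso := act_isometry adj d gm G act action.

(* Elements moving both ends of a long segment [x, y] by at most [eps] act on its middle
   part as a shift, determined by the image of [z]; two of them with the same shift differ
   by an element fixing a middle segment of length 3. *)
Lemma acylindrical_of_stabilizers (K : nat) :
  (forall x y, d x y = 3 -> forall gs, NoDup gs ->
    (forall g, In g gs -> Fix act g x /\ Fix act g y) -> length gs <= K) ->
  acylindrical G adj act.
Proof.
(* This length leaves room for [z] and [z'] at distance 3, both farther than [eps] from the ends, so
   that their images stay on the segment. The image of [z] is closer than [2 * eps + 2] to [x],
   which bounds the number of shifts. *)
move=> stab eps; exists (2 * eps + 5), ((2 * eps + 2) * K) => x y /(dist_geE adj d gm) far gs nd H.
have [|z [xz zy]] := tm_between d tm x y (eps + 1); first by lia.
have [|z' [zz' zy']] := tm_between d tm z y 3; first by lia.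
have xz' : d x z' = eps + 4.
  by have := tm_tri d tm x z z'; have := tm_tri d tm x z' y; lia.
have key g : In g gs -> d x (act g z) + d (act g z) y = d x y /\
    d x (act g z') = d x (act g z) + 3 /\ d x (act g z') + d (act g z') y = d x y /\
    d x (act g z) < 2 * eps + 2.
  move=> /H [/(dist_leE adj d gm) gx /(dist_leE adj d gm) gy].
  have e1 := iso g x z; have e2 := iso g z y; have e3 := iso g x y.
  have e4 := iso g x z'; have e5 := iso g z z'; have e6 := iso g z' y.
  have main w : d (act g x) w + d w (act g y) = d x y -> eps < d (act g x) w ->
      eps < d w (act g y) -> d x w + d w y = d x y.
    move=> ew l1 l2.
    four_points tm x (act g x) w (act g y); four_points tm x y w (act g y).
    have := tm_tri d tm x w y; have := tm_tri d tm (act g x) x w.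
    have := tm_tri d tm w y (act g y); have := tm_tri d tm x (act g x) w.
    by lia.
  have m1 := main (act g z) ltac:(lia) ltac:(lia) ltac:(lia).
  have m2 := main (act g z') ltac:(lia) ltac:(lia) ltac:(lia).
  have := tm_tri d tm x (act g x) (act g z).
  have : d x (act g z') = d x (act g z) + 3.
    have := tm_tri d tm (act g x) x (act g z).
    by four_points tm x (act g x) (act g z) (act g z'); lia.
  by lia.
apply: (length_le_fibers (fun g => d x (act g z)) _ _ _ nd) => [g /key [_ [_ []]] //|m l ndl Hl].
case: l ndl Hl => [|g0 l] ndl Hl; first by rewrite /=; lia.
rewrite -(length_map (fun g => mul (inv g0) g)).
apply: (stab z z' zz').
  by apply: NoDup_map_inj ndl => g h _ _; apply: mulgI.
have [i0 e0] := Hl g0 (or_introl eq_refl).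
have [a1 [a2 [a3 _]]] := key g0 i0.
move=> k /in_map_iff [g [<- /Hl [ig eg]]].
have [b1 [b2 [b3 _]]] := key g ig.
have ez : act g z = act g0 z by apply: (between_unique d tm x y); lia.
have ez' : act g z' = act g0 z' by apply: (between_unique d tm x y); lia.
by rewrite /Fix !actM ez ez' -!actM mulVg !act1.
Qed.

(** If neither [u] nor [v] lies on the segment from [o] to the other, the segments have branched
    before reaching them; prolonging them leaves the Gromov product at [o] unchanged. *)
Lemma gromov_product_rays o u v u' v' :
  d o u' = d o u + d u u' -> d o v' = d o v + d v v' ->
  d o v < d o u + d u v -> d o u < d o v + d u v ->
  d o u' + d o v' + d u v = d o u + d o v + d u' v'.
Proof.
move=> eu ev lu lv.
have X : d u' v + d o u = d o u' + d u v by four_points tm o u u' v; lia.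
by four_points tm o v v' u'; have := tm_sym d tm u' v; lia.
Qed.

(** For positive displacement this says that [o] lies on the axis of [g]. *)
Definition axial (o : T) (g : G) : Prop :=
  forall n : nat, d o (act (gpow g (Z.of_nat n)) o) = n * d o (act g o).

Lemma displacement_inv o g : d o (act (inv g) o) = d o (act g o).
Proof. by rewrite -{1}(iso g) -actM mulgV act1 (tm_sym d tm). Qed.

Lemma axial_inv o g : axial o g -> axial o (inv g).
Proof. by move=> ax n; rewrite gpow_inv gpow_opp !displacement_inv; apply: ax. Qed.

Lemma axial_dist o g m n : axial o g ->
  d (act (gpow g m) o) (act (gpow g n) o) = Z.to_nat (Z.abs (m - n)) * d o (act g o).
Proof.
move=> ax; rewrite -(iso (gpow g (- m))) -!actM -!gpow_add Z.add_opp_diag_l act1.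
case: (Z_le_gt_dec m n) => le.
  by have := ax (Z.to_nat (n - m)); rewrite Z2Nat.id; [lia | have -> : (- m + n = n - m)%Z by lia];
    move=> ->; congr (_ * _); lia.
have := ax (Z.to_nat (m - n)); rewrite Z2Nat.id; first lia.
rewrite -displacement_inv -gpow_opp; have -> : (- (m - n) = - m + n)%Z by lia.
by move=> ->; congr (_ * _); lia.
Qed.

Lemma axial_loxodromic o g : axial o g -> 0 < d o (act g o) -> loxodromic G adj act g.
Proof.
move=> ax pos; exists o, (INR (d o (act g o))), 0%R.
have l1 : (1 <= INR (d o (act g o)))%R by apply: (le_INR 1).
split=> //; split; first lra.
move=> m n k /(is_distE adj d gm) ->.
rewrite (axial_dist o g m n ax) mult_INR (INR_IZR_INZ (Z.to_nat _)) Z2Nat.id; first lia.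
have p : (0 <= IZR (Z.abs (m - n)))%R by apply: IZR_le; lia.
split; last by lra.
rewrite Rminus_0_r Rmult_comm; apply: Rmult_le_compat_l => //.
apply: (Rle_trans _ 1); last by [].
by rewrite -Rinv_1; apply: Rinv_le_contravar; lra.
Qed.

(* The two geodesics from [o] to [g o] and to [h o] have common part shorter than both. *)
Definition rays_split (o : T) (g h : G) : Prop :=
  d o (act h o) < d o (act g o) + d (act g o) (act h o) /\
  d o (act g o) < d o (act h o) + d (act g o) (act h o).

Lemma rays_split_sym o g h : rays_split o g h -> rays_split o h g.
Proof. by rewrite /rays_split (tm_sym d tm (act h o)); tauto. Qed.

Lemma gpow_sgnZ (g : G) s n :
  gpow g (sgnZ s n) = gpow (if s then g else inv g) (Z.of_nat n).
Proof. by case: s; rewrite //= gpow_inv. Qed.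

Lemma axial_independent o g h : axial o g -> axial o h ->
  (forall s t : bool, rays_split o (if s then g else inv g) (if t then h else inv h)) ->
  independent G adj act g h.
Proof.
move=> axg axh split o' s t.
set g' := if s then g else inv g; set h' := if t then h else inv h.
have axg' : axial o g' by rewrite /g'; case: (s) => //; apply: axial_inv.
have axh' : axial o h' by rewrite /h'; case: (t) => //; apply: axial_inv.
have [lu lv] := split s t; rewrite -/g' -/h' in lu lv.
have bound n m : d o (act (gpow g' (Z.of_nat n)) o) + d o (act (gpow h' (Z.of_nat m)) o) <=
    d o (act g' o) + d o (act h' o) +
    d (act (gpow g' (Z.of_nat n)) o) (act (gpow h' (Z.of_nat m)) o).
{ case: n => [|n]; first by rewrite act1 (tm_refl d tm); lia.
  case: m => [|m].
    by rewrite act1 (tm_refl d tm) (tm_sym d tm _ o); lia.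
  have seg k x : axial o x -> d o (act (gpow x (Z.of_nat (S k))) o) =
      d o (act x o) + d (act x o) (act (gpow x (Z.of_nat (S k))) o).
    move=> ax; rewrite ax Nat2Z.inj_succ gpow_succ actM iso ax; lia.
  have := gromov_product_rays o _ _ _ _ (seg n g' axg') (seg m h' axh') lu lv.
  by lia. }
(* Changing the base point from [o] to [o'] alters each of the three distances by at most
   [2 * d o o']. *)
exists (d o (act g' o) + d o (act h' o) + 6 * d o o') => n m a b c.
move=> /(is_distE adj d gm) -> /(is_distE adj d gm) -> /(is_distE adj d gm) ->.
rewrite !gpow_sgnZ -/g' -/h'.
have move_base k : d o' (act k o') <= d o (act k o) + 2 * d o o'.
  have := tm_tri d tm o' o (act k o'); have := tm_tri d tm o (act k o) (act k o').
  by rewrite iso (tm_sym d tm o' o); lia.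
have e1 := move_base (gpow g' (Z.of_nat n)); have e2 := move_base (gpow h' (Z.of_nat m)).
have := bound n m.
have := tm_tri d tm (act (gpow g' (Z.of_nat n)) o) (act (gpow g' (Z.of_nat n)) o')
  (act (gpow h' (Z.of_nat m)) o).
have := tm_tri d tm (act (gpow g' (Z.of_nat n)) o') (act (gpow h' (Z.of_nat m)) o')
  (act (gpow h' (Z.of_nat m)) o).
by rewrite !iso (tm_sym d tm o' o); lia.
Qed.

(* Positive words in [p] and [q] displace [o] by twice their length, and words with
   different first letters branch at distance 1 from [o]. *)
Section TwoGenerators.
Context (o : T).

Inductive positive (p q : G) : nat -> G -> Prop :=
| positive_one : positive p q 0 one
| positive_l n g : positive p q n g -> positive p q (S n) (mul p g)
| positive_r n g : positive p q n g -> positive p q (S n) (mul q g).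

Lemma positive_mul p q m n g h : positive p q m g -> positive p q n h ->
  positive p q (m + n) (mul g h).
Proof.
elim=> [|{}m {}g _ IH|{}m {}g _ IH] ph; first by rewrite mul1g.
  by rewrite -mulA; apply: positive_l; apply: IH.
by rewrite -mulA; apply: positive_r; apply: IH.
Qed.

Lemma positive_gpow p q k n g : positive p q k g ->
  positive p q (n * k) (gpow g (Z.of_nat n)).
Proof.
move=> pg; elim: n => [|n IH]; first exact: positive_one.
by rewrite Nat2Z.inj_succ gpow_succ; apply: positive_mul.
Qed.

Lemma positive_gpow_l p q n : positive p q n (gpow p (Z.of_nat n)).
Proof.
elim: n => [|n IH]; first exact: positive_one.
by rewrite Nat2Z.inj_succ gpow_succ; apply: positive_l.
Qed.

Lemma positive_gpow_r p q n : positive p q n (gpow q (Z.of_nat n)).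
Proof.
elim: n => [|n IH]; first exact: positive_one.
by rewrite Nat2Z.inj_succ gpow_succ; apply: positive_r.
Qed.

(** Local conditions: distance 4 means that consecutive segments of length 2 do not backtrack, and
    the last clause that the segments to [p o] and [q o] part halfway. *)
Definition branching (p q : G) : Prop :=
  (forall u, u = p \/ u = q -> d o (act u o) = 2) /\
  (forall u v, u = p \/ u = q -> v = p \/ v = q -> d o (act u (act v o)) = 4) /\
  d (act p o) (act q o) = 2.

Lemma positive_dist p q n g : branching p q -> positive p q n g -> d o (act g o) = 2 * n.
Proof.
move=> [b1 [b2 _]].
have inv_pos m k : positive p q (S m) k ->
    exists u k', (u = p \/ u = q) /\ positive p q m k' /\ k = mul u k'.
  by move=> H; inversion H as [|? h ph|? h ph]; subst; [exists p, h | exists q, h]; auto.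
elim/(well_founded_induction lt_wf): n g => -[|[|n]] IH g pg.
- by inversion pg; subst; rewrite act1 (tm_refl d tm).
- have [u [k [iu [pk ->]]]] := inv_pos _ _ pg.
  by inversion pk; subst; rewrite mulg1 b1.
- have [u [k [iu [pk ->]]]] := inv_pos _ _ pg.
  have ek := IH (S n) ltac:(lia) k pk.
  have [v [k' [iv [pk' E]]]] := inv_pos _ _ pk.
  have ek' := IH n ltac:(lia) k' pk'.
  have := between_trans d tm o (act u o) (act u (act v o)) (act u (act v (act k' o))).
  rewrite !iso b1 // (b2 u v) // (b1 v) // ek' -actM -E ek actM => ->; lia.
Qed.

Lemma positive_branch p q m n g h : branching p q -> positive p q m g -> positive p q n h ->
  d (act (mul p g) o) (act (mul q h) o) = 2 * m + 2 * n + 2.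
Proof.
move=> br pg ph; have [b1 [_ b3]] := br.
have e1 := positive_dist p q _ _ br (positive_l _ _ _ _ pg).
have e2 := positive_dist p q _ _ br (positive_r _ _ _ _ ph).
have f1 := positive_dist p q _ _ br pg; have f2 := positive_dist p q _ _ br ph.
rewrite -(iso p) -actM in f1; rewrite -(iso q) -actM in f2.
have g1 := b1 p (or_introl eq_refl); have g2 := b1 q (or_intror eq_refl).
have X : d (act (mul p g) o) (act q o) = 2 * m + 2.
  by four_points tm o (act p o) (act (mul p g) o) (act q o); lia.
by four_points tm o (act q o) (act (mul q h) o) (act (mul p g) o); lia.
Qed.

Definition block (p q : G) (i : nat) : G := mul (gpow p (Z.of_nat i)) (gpow q (Z.of_nat i)).

Lemma block_positive p q i : positive p q (2 * i) (block p q i).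
Proof.
replace (2 * i) with (i + i) by lia.
by apply: positive_mul; [apply: positive_gpow_l | apply: positive_gpow_r].
Qed.

Lemma block_axial p q i : branching p q -> axial o (block p q i).
Proof.
move=> br n; have pb := block_positive p q i.
rewrite (positive_dist p q _ _ br pb) (positive_dist p q _ _ br (positive_gpow p q _ n _ pb)).
by lia.
Qed.

Lemma block_inv p q i : inv (block p q i) = block (inv q) (inv p) i.
Proof. by rewrite /block invMg !gpow_inv !gpow_opp. Qed.

Lemma block_split p q i j : branching p q -> i < j ->
  rays_split o (block p q (S i)) (block p q (S j)).
Proof.
move=> br lt; rewrite /rays_split.
rewrite !(positive_dist p q _ _ br (block_positive p q _)).
(* After cancelling the common prefix, a power of [p], one word begins with [q] and the other with
   [p], so [positive_branch] applies. *)
have -> : d (act (block p q (S i)) o) (act (block p q (S j)) o) = 4 * j + 2.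
  rewrite /block.
  have -> : Z.of_nat (S j) = (Z.of_nat (S i) + Z.of_nat (S (j - i - 1)))%Z by lia.
  rewrite gpow_add -mulA !actM iso -actM.
  rewrite {1}Nat2Z.inj_succ gpow_succ (Nat2Z.inj_succ (j - i - 1)) gpow_succ -mulA.
  rewrite (tm_sym d tm).
  rewrite -Nat2Z.inj_succ -Nat2Z.inj_add.
  have p1 := positive_gpow_r p q i.
  have p2 := positive_mul p q _ _ _ _ (positive_gpow_l p q (j - i - 1))
    (positive_gpow_r p q (S i + S (j - i - 1))).
  by rewrite (positive_branch p q _ _ _ _ br p2 p1); lia.
by lia.
Qed.

Lemma non_elementary_of_branching p q : branching p q -> branching (inv q) (inv p) ->
  non_elementary G adj act.
Proof.
move=> br br'; exists (fun i => block p q (S i)).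
have disp i : d o (act (block p q i) o) = 4 * i.
  by rewrite (positive_dist p q _ _ br (block_positive p q i)); lia.
split; first by move=> i j E; have := disp (S i); rewrite E disp; lia.
split.
  by move=> i; apply: (axial_loxodromic o); [apply: block_axial | rewrite disp; lia].
(* Moving by the block with index [S j] turns the distance into the displacement of a positive word,
   which is the sum of the two displacements. *)
have cross i j : rays_split o (block p q (S i)) (inv (block p q (S j))).
  rewrite /rays_split displacement_inv !disp.
  rewrite -(iso (block p q (S j)) (act _ _)) -!actM mulgV act1 (tm_sym d tm).
  have := positive_mul p q _ _ _ _ (block_positive p q (S j)) (block_positive p q (S i)).
  by move=> /(positive_dist p q _ _ br) ->; lia.
have same i j : i <> j -> rays_split o (block p q (S i)) (block p q (S j)).
  move=> ne; case: (Nat.lt_trichotomy i j) => [|[|]] // lt; first exact: block_split.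
  by apply: rays_split_sym; apply: block_split.
have same' i j : i <> j -> rays_split o (inv (block p q (S i))) (inv (block p q (S j))).
  rewrite !block_inv => ne; case: (Nat.lt_trichotomy i j) => [|[|]] // lt.
    exact: block_split.
  by apply: rays_split_sym; apply: block_split.
move=> i j ne; apply: (axial_independent o); try exact: block_axial.
move=> [] []; [exact: same | exact: cross | | exact: same'].
by apply: rays_split_sym; apply: cross.
Qed.
End TwoGenerators.
End Criteria.

(** * The tree of an amalgam of two subgroups *)

Section CosetTree.
Context {G : group} (P : bool -> G -> Prop).
Context (P_group : forall t, P t one /\ (forall g h, P t g -> P t h -> P t (mul g h)) /\
  (forall g, P t g -> P t (inv g))).
Context (P_generated : forall Q : G -> Prop, Q one ->
  (forall t g h, P t g -> Q h -> Q (mul g h)) -> forall g, Q g).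
Context (P_alternating : forall t r g, altprod P t r g -> ~ P (negb r) g).

Let P1 t : P t one := proj1 (P_group t).
Let PM t : forall g h, P t g -> P t h -> P t (mul g h) := proj1 (proj2 (P_group t)).
Let PV t : forall g, P t g -> P t (inv g) := proj2 (proj2 (P_group t)).

Definition lcoset (t : bool) (g : G) : G -> Prop := fun y => P t (mul (inv g) y).

(** A coset is kept as a predicate together with the fact that it is one; equal cosets are then
    equal vertices, without a quotient. *)
Definition vertex : Type := {x : bool * (G -> Prop) | exists g, snd x = lcoset (fst x) g}.

Definition mk (t : bool) (g : G) : vertex :=
  exist _ (t, lcoset t g) (ex_intro _ g eq_refl).

Definition tag (x : vertex) : bool := fst (proj1_sig x).

Lemma vertex_ext (x y : vertex) : proj1_sig x = proj1_sig y -> x = y.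
Proof. by apply: eq_sig_hprop => ? ? ?; apply: proof_irrelevance. Qed.

Lemma vertexP (x : vertex) : exists g, x = mk (tag x) g.
Proof.
case: x => -[t S] [g e]; exists g; apply: vertex_ext => /=.
by rewrite /tag /=; congr pair.
Qed.

Lemma mk_eq t g h : P t (mul (inv g) h) -> mk t g = mk t h.
Proof.
move=> H; apply: vertex_ext => /=; congr pair.
apply: functional_extensionality => y; apply: propositional_extensionality.
rewrite /lcoset; split=> H'.
  have -> : mul (inv h) y = mul (inv (mul (inv g) h)) (mul (inv g) y) by grp.
  by apply: PM => //; apply: PV.
have -> : mul (inv g) y = mul (mul (inv g) h) (mul (inv h) y) by grp.
exact: PM.
Qed.

Lemma mk_inj t t' g h : mk t g = mk t' h -> t = t' /\ P t (mul (inv g) h).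
Proof.
move=> [<- E]; split=> //; have : lcoset t h h by rewrite /lcoset mulVg.
by rewrite -E.
Qed.

Lemma mk_mul t g s : P t s -> mk t g = mk t (mul g s).
Proof. by move=> Ps; apply: mk_eq; rewrite mulKg. Qed.

Definition cact_set (h : G) (x : bool * (G -> Prop)) : bool * (G -> Prop) :=
  (fst x, fun y => snd x (mul (inv h) y)).

Lemma cact_coset h t g : cact_set h (t, lcoset t g) = (t, lcoset t (mul h g)).
Proof.
rewrite /cact_set /=; congr pair; apply: functional_extensionality => y.
by rewrite /lcoset; congr P; grp.
Qed.

Lemma cact_vertex h (x : vertex) :
  exists g, snd (cact_set h (proj1_sig x)) = lcoset (fst (cact_set h (proj1_sig x))) g.
Proof.
have [g ->] := vertexP x; exists (mul h g).
by rewrite [proj1_sig _]/= cact_coset.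
Qed.

Definition cact (h : G) (x : vertex) : vertex := exist _ _ (cact_vertex h x).

Lemma cact_mk h t g : cact h (mk t g) = mk t (mul h g).
Proof. by apply: vertex_ext; rewrite /= cact_coset. Qed.

Definition vadj (x y : vertex) : Prop := exists t g, x = mk t g /\ y = mk (negb t) g.

Lemma vadj_sym x y : vadj x y -> vadj y x.
Proof. by move=> [t [g [-> ->]]]; exists (negb t), g; rewrite negb_involutive. Qed.

Lemma vadj_mk t g x : vadj (mk t g) x ->
  exists s, P t s /\ mk t g = mk t (mul g s) /\ x = mk (negb t) (mul g s).
Proof.
move=> [t' [g' [E ->]]]; have [Et Ps] := mk_inj _ _ _ _ E; subst t'.
exists (mul (inv g) g'); split=> //.
by rewrite mulVKg.
Qed.

Lemma walk_sym {T : Type} (adj : T -> T -> Prop) x y :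
  (forall x y, adj x y -> adj y x) ->
  (exists l, is_walk adj x l y) -> exists l, is_walk adj y l x.
Proof.
move=> sym [l]; elim: l x => [|z l IH] x /=; first by move=> ->; exists [].
move=> [xz /IH [l' h]]; exists (l' ++ [x]); apply: is_walk_app h _.
by split=> //; apply: sym.
Qed.

Lemma coset_tree_connected x y : exists l, is_walk vadj x l y.
Proof.
pose conn x y := exists l, is_walk vadj x l y.
have tr a b c : conn a b -> conn b c -> conn a c.
  by move=> [l h] [l' h']; exists (l ++ l'); apply: is_walk_app h h'.
have refl a : conn a a by exists [].
have edge t g : conn (mk t g) (mk (negb t) g).
  by exists [mk (negb t) g]; split=> //; exists t, g.
(* For a product [mul s h], a path to [mk true s] is followed by the translate by [s] of a path to
   [mk true h]. *)
have base g : conn (mk true one) (mk true g).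
{ move: g; apply: P_generated => [//|t s h Ps [l Hl]].
  apply: (tr _ (mk true s)).
    case: t Ps => Ps; first by rewrite -(mul1g _ s) -mk_mul.
    apply: (tr _ (mk false one)); first exact: edge.
    by rewrite (mk_mul false one s) // mul1g; apply: (edge false).
  exists (map (cact s) l); rewrite -{1}(mulg1 _ s) -!cact_mk.
  elim: l (mk true one) Hl => [|z l IH] a /= => [-> //|[az h']].
  split; last exact: IH.
  by case: az => t' [g' [-> ->]]; exists t', (mul s g'); rewrite !cact_mk. }
have baset t g : conn (mk true one) (mk t g).
  by case: t; [exact: base | apply: (tr _ (mk true g)); [exact: base | exact: edge]].
have [g ->] := vertexP x; have [h ->] := vertexP y.
apply: (tr _ (mk true one)); last exact: baset.
by apply: (walk_sym _ _ _ vadj_sym); apply: baset.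
Qed.

(** Each turn of the walk at a vertex contributes one factor, and the absence of backtracking keeps
    that factor out of the other subgroup. A closed reduced walk would thus contradict
    [P_alternating]. *)
Lemma reduced_walk_altprod l t g y :
  is_walk vadj (mk (negb t) g) l y -> no_backtrack (mk t g) (mk (negb t) g :: l) ->
  y = mk (negb t) g \/
  exists r s, altprod P (negb t) r s /\ y = mk (negb r) (mul g s).
Proof.
elim: l t g => [|z l IH] t g /=; first by left.
move=> [/vadj_mk [s [Ps [E ->]]] h] [ne nb]; right.
rewrite negb_involutive in ne h.
have nPs : ~ P (negb (negb t)) s.
  by rewrite negb_involutive => Pt; apply: ne; apply: mk_mul.
have [||e|[r [s' [alt e]]]] := IH (negb t) (mul g s).
- by rewrite negb_involutive.
- by rewrite -E.
- by exists (negb t), s; split=> //; apply: altprod_one.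
- exists r, (mul s s'); split; last by rewrite mulA.
  exact: altprod_cons.
Qed.

Lemma coset_is_tree : is_tree vadj.
Proof.
split; first by split; exact: (mk true one).
split; first exact: vadj_sym.
split; first by move=> x [t [g [-> /mk_inj []]]]; case: t.
split; first exact: coset_tree_connected.
move=> x [//|z l] /= [[t [g [Ex ->]]] h] nb.
rewrite {}Ex in h nb.
have [/mk_inj [e _]|[r [s [alt /mk_inj [e Ps]]]]] := reduced_walk_altprod l t g _ h nb.
  by case: (t) e.
by case: (P_alternating _ _ _ alt); rewrite -e -(mulKg g s).
Qed.

Lemma coset_action : is_tree_action G vadj cact.
Proof.
have actM g h x : cact (mul g h) x = cact g (cact h x).
  by have [k ->] := vertexP x; rewrite !cact_mk mulA.
split; first by move=> x; have [k ->] := vertexP x; rewrite cact_mk mul1g.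
split=> //; split.
  by move=> g x y [t [h [-> ->]]]; exists t, (mul g h); rewrite !cact_mk.
move=> g x y [t [h [-> ->]]]; rewrite cact_mk => /mk_inj [e _].
by case: (t) e.
Qed.

Lemma cact_fix h t g : cact h (mk t g) = mk t g -> P t (mul (inv g) (mul h g)).
Proof. by rewrite cact_mk => H; case: (mk_inj _ _ _ _ (eq_sym H)). Qed.

(** Translating the middle edge of a path with 3 edges to the base edge turns the stabilizer of the
    path into the set counted in the hypothesis; [s] and [r] give the two outer vertices. *)
Lemma coset_tree_acylindrical (K : nat) :
  (forall t s r, P t s -> ~ P (negb t) s -> P (negb t) r -> ~ P t r ->
    forall gs, NoDup gs -> (forall g, In g gs -> P t g /\ P (negb t) g /\
      P (negb t) (mul (inv s) (mul g s)) /\ P t (mul (inv r) (mul g r))) ->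
    length gs <= K) ->
  acylindrical G vadj cact.
Proof.
move=> count; have [d [tm gm]] := is_tree_metric vadj coset_is_tree.
apply: (acylindrical_of_stabilizers coset_action d tm gm K) => x y xy gs nd Hgs.
have iso := act_isometry vadj d gm G cact coset_action.
have dwalk a b l : is_walk vadj a l b -> d a b <= length l by apply: (proj1 (gm a b)).
have [_ [_ [l [h]]]] := gm x y; rewrite xy.
case: l h => [//|u [//|v [//|w [|//]]]] /= [xu [uv [vw E]]] _; subst w.
have uy : d u y = 2.
  have := tm_tri d tm x u y; have := dwalk x u [u] (conj xu eq_refl).
  by have := dwalk u y [v; y] (conj uv (conj vw eq_refl)) => /=; lia.
have xv : d x v = 2.
  have := tm_tri d tm x v y; have := dwalk v y [y] (conj vw eq_refl).
  by have := dwalk x v [u; v] (conj xu (conj uv eq_refl)) => /=; lia.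
have du : d x u = 1.
  by have := tm_tri d tm x u y; have := dwalk x u [u] (conj xu eq_refl) => /=; lia.
have dv : d v y = 1.
  by have := tm_tri d tm x v y; have := dwalk v y [y] (conj vw eq_refl) => /=; lia.
case: uv => t [g [Eu Ev]]; subst u v.
have [s [Ps [Es Ex]]] := vadj_mk _ _ _ (vadj_sym _ _ xu).
have [r [Pr [Er Ey]]] := vadj_mk _ _ _ vw.
rewrite negb_involutive in Ey; subst x y.
have ns : ~ P (negb t) s.
  by move=> H; move: xv; rewrite -(mk_mul (negb t) g s H) (tm_refl d tm).
have nr : ~ P t r.
  by move=> H; move: uy; rewrite -(mk_mul t g r H) (tm_refl d tm).
rewrite -(length_map (fun k => mul (inv g) (mul k g))).
apply: (count t s r Ps ns Pr nr).
  apply: NoDup_map_inj nd => k k' _ _ /mulgI; exact: mulIg.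
move=> k' /in_map_iff [k [<- /Hgs [fx fy]]].
have cvx := Fix_convex d tm cact iso k _ _ _ fx fy.
have fu : cact k (mk t g) = mk t g by apply: cvx; lia.
have fv : cact k (mk (negb t) g) = mk (negb t) g by apply: cvx; lia.
split; first exact: cact_fix.
split; first exact: cact_fix.
by split; [have := cact_fix _ _ _ fx | have := cact_fix _ _ _ fy]; grp.
Qed.

(** As [y] fixes [o], the elements [mul x y] and [mul x' y] move [o] as [x] and [x'] do, to distance
    2 through [mk t one]. The condition on [mul (inv x) x'] makes them branch, the one on
    [mul x (inv x')] makes their inverses branch. *)
Lemma coset_tree_non_elementary t x x' y :
  P t x -> ~ P (negb t) x -> P t x' -> ~ P (negb t) x' ->
  ~ P (negb t) (mul (inv x) x') -> ~ P (negb t) (mul x (inv x')) ->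
  P (negb t) y -> ~ P t y ->
  non_elementary G vadj cact.
Proof.
move=> Px nx Px' nx' n1 n2 Py ny.
have [d [tm gm]] := is_tree_metric vadj coset_is_tree.
have iso := act_isometry vadj d gm G cact coset_action.
have actM := proj1 (proj2 coset_action).
pose o := mk (negb t) one.
have ne t' g h : ~ P t' (mul (inv g) h) -> mk t' g <> mk t' h by move=> n /mk_inj [].
have e1 g : vadj (mk t g) (mk (negb t) g) by exists t, g.
have e2 g : vadj (mk (negb t) g) (mk t g) by apply: vadj_sym.
have reduced_dist a l b : is_walk vadj a l b -> no_backtrack a l -> d a b = length l.
  by apply: (proj1 (proj2 (gm a b))).
have step g u : P t u -> vadj (mk (negb t) (mul g u)) (mk t g).
  by move=> Pu; rewrite (mk_mul t g u).
have d2 u v : P t u -> P t v -> ~ P (negb t) (mul (inv u) v) ->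
    d (mk (negb t) u) (mk (negb t) v) = 2.
  move=> Pu Pv n.
  apply: (reduced_dist _ [mk t one; mk (negb t) v]) => /=.
    have := step one u Pu; have := step one v Pv; rewrite !mul1g => sv su.
    by split=> //; split=> //; apply: vadj_sym.
  by split=> //; apply: ne.
have d4 u v : P t u -> ~ P (negb t) u -> P t v -> ~ P (negb t) v ->
    d o (mk (negb t) (mul u (mul y v))) = 4.
  move=> Pu nu Pv nv.
  have Ey : mk (negb t) u = mk (negb t) (mul u y) by apply: mk_mul.
  apply: (reduced_dist _ [mk t one; mk (negb t) u; mk t (mul u y); mk (negb t) (mul u (mul y v))]) => /=.
    have := step one u Pu; rewrite mul1g => su; have := step (mul u y) v Pv; rewrite -mulA => sv.
    do !split => //; try exact: e2; try by apply: vadj_sym.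
    by rewrite Ey.
  split; first by apply: ne; grp.
  split; last by split=> //; rewrite Ey; apply: ne; grp.
  rewrite (mk_mul t one u Pu) mul1g; apply: ne; by grp.
have oy g : cact (mul g y) o = mk (negb t) g.
  by rewrite /o cact_mk mulg1 -mk_mul.
have oyV g : P t g -> cact (inv (mul g y)) o = cact (inv y) (mk (negb t) (inv g)).
  by move=> Pg; rewrite invMg actM /o cact_mk mulg1.
have br : branching d (act := cact) o (mul x y) (mul x' y).
{ split; last split.
  - move=> u [->|->]; rewrite oy /o; apply: d2 => //; rewrite ?invg1 ?mul1g //.
  - by move=> u v [->|->] [->|->]; rewrite oy cact_mk -mulA; apply: d4.
  - by rewrite !oy; apply: d2. }
have dV u : d o (cact (inv u) o) = d o (cact u o).
  by rewrite -{1}(iso u) -actM mulgV (proj1 coset_action) (tm_sym d tm).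
have br' : branching d (act := cact) o (inv (mul x' y)) (inv (mul x y)).
{ have [b1 [b2 b3]] := br; split; last split.
  - by move=> u [->|->]; rewrite dV b1; auto.
  - by move=> u v [->|->] [->|->]; rewrite -actM -invMg dV actM b2; auto.
  - rewrite !oyV // iso; apply: d2; try exact: PV.
    rewrite invgK => H; apply: n2; rewrite -(invgK (mul x (inv x'))); apply: PV.
    by rewrite invMg invgK. }
exact: (non_elementary_of_branching coset_action d tm gm o _ _ br br').
Qed.
End CosetTree.

(** * Arboreality from a separated pair *)

Section Backward.
Context {V : Type} {E : V -> V -> Prop} {Gv : V -> group} {G : group}
  {iota : forall v, Gv v -> G}.
Context (E_sym : forall u v, E u v -> E v u)
  (E_irr : forall v, ~ E v v) (GP : is_graph_product E Gv G iota)
  (nontrivial : forall v, exists x : Gv v, x <> one).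
Context (e : bool -> V) (e_neq : e true <> e false) (e_nonadj : ~ E (e true) (e false)).
Context (link_finite : finite_subgroup (in_full iota (link2 E (e true) (e false)))).

Let P := side (iota := iota) e.
Let einj := e_inj e e_neq.

Lemma side_stabilizers_bounded : exists K, forall t s r,
  P t s -> ~ P (negb t) s -> P (negb t) r -> ~ P t r ->
  forall gs, NoDup gs -> (forall g, In g gs -> P t g /\ P (negb t) g /\
      P (negb t) (mul (inv s) (mul g s)) /\ P t (mul (inv r) (mul g r))) ->
  length gs <= K.
Proof.
have [l Hl] := link_finite; exists (length l) => t s r Ps ns Pr nr gs nd Hgs.
have [h Hh] := side_stabilizer E_sym E_irr GP e e_neq e_nonadj t s Ps ns.
have [|h' Hh'] := side_stabilizer E_sym E_irr GP e e_neq e_nonadj (negb t) r Pr.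
  by rewrite negb_involutive.
rewrite negb_involutive in Hh'.
pose R := retr GP (E (e t)); have hR : is_hom R := retr_hom GP _.
(* [R] fixes the conjugate of [g] by [h]; so conjugating [g] by [mul h n] gives the image under [R]
   of its conjugate by [h'], which lies in the finite full subgroup on the common link. *)
pose n := R (mul (inv h) h').
rewrite -(length_map (fun g => mul (inv (mul h n)) (mul g (mul h n)))).
apply: NoDup_incl_length.
  by apply: NoDup_map_inj nd => k k' _ _ /mulgI; apply: mulIg.
move=> z /in_map_iff [g [<- /Hgs [g1 [g2 [g3 g4]]]]]; apply: Hl.
have f1 := Hh g g1 g2 g3; have f2 := Hh' g g2 g1 g4.
have -> : mul (inv (mul h n)) (mul g (mul h n)) = R (mul (inv h') (mul g h')).
  have e1 : mul (inv h') (mul g h') = mul (inv (mul (inv h) h'))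
      (mul (mul (inv h) (mul g h)) (mul (inv h) h')) by grp.
  have e2 : R (mul (inv h) (mul g h)) = mul (inv h) (mul g h) by apply: retr_id.
  by rewrite e1 hR hR (hom_inv _ _ hR) e2 -/n; grp.
apply: full_mono (retr_full GP (E (e t)) _ _ f2) => v [v1 v2].
by case: (t) v1 v2 => /= v1 v2; split.
Qed.

Lemma arboreal_of_three_cosets t x x' y :
  P t x -> ~ P (negb t) x -> P t x' -> ~ P (negb t) x' ->
  ~ P (negb t) (mul (inv x) x') -> ~ P (negb t) (mul x (inv x')) ->
  P (negb t) y -> ~ P t y -> acylindrically_arboreal G.
Proof.
move=> Px nx Px' nx' n1 n2 Py ny.
have grpP t' := side_group (iota := iota) e t'.
have genP := side_generated GP e e_neq.
have altP := altprod_side E_sym E_irr GP e e_neq e_nonadj.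
have [K HK] := side_stabilizers_bounded.
exists (vertex P), (vadj P), (cact P).
split; first exact: coset_is_tree grpP genP altP.
split; first exact: coset_action.
split; first exact: (coset_tree_acylindrical P grpP genP altP K HK).
exact: (coset_tree_non_elementary P grpP genP altP t x x' y).
Qed.

(** * Three cosets on one side, or a dihedral group up to a finite factor *)

Lemma base_side t v (x : Gv v) : v <> e (negb t) -> P t (iota v x).
Proof. by move=> n; apply: full_gen. Qed.

Lemma base_not_side t (x : Gv (e t)) : x <> one -> ~ P (negb t) (iota _ x).
Proof. by move=> nx; apply: (iota_not_full E_irr GP) => //; rewrite negb_involutive; apply. Qed.

Lemma e_negb t : e t <> e (negb t).
Proof. by move/einj; case: t. Qed.

Lemma arboreal_of_large_vertex_group t (x x' : Gv (e t)) :
  x <> one -> x' <> one -> x <> x' -> acylindrically_arboreal G.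
Proof.
move=> nx nx' ne; have [y ny] := nontrivial (e (negb t)).
have s z : P t (iota (e t) z) by apply: base_side; apply: e_negb.
apply: (arboreal_of_three_cosets t (iota _ x) (iota _ x') (iota _ y)) => //;
  try exact: base_not_side.
- rewrite -(hom_inv _ _ (iota_hom GP _)) -(iota_hom GP); apply: base_not_side => H.
  by apply: ne; apply: (mulgI (inv x)); rewrite mulVg H.
- rewrite -(hom_inv _ _ (iota_hom GP _)) -(iota_hom GP); apply: base_not_side => H.
  by apply: ne; apply: (mulIg (inv x')); rewrite mulgV H.
- by apply: base_side; rewrite negb_involutive => /einj; case: (t).
- by have := base_not_side (negb t) y ny; rewrite negb_involutive.
Qed.

(** The second coset comes from conjugating [g] by an element [c] of the group at [w]. If it failed
    to be new, [side_stabilizer] would place a conjugate of [c] in the link subgroup of [e t], which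
    the retraction onto the group at [w] kills. *)
Lemma arboreal_of_nonadjacent t w : others e w -> ~ E (e t) w -> acylindrically_arboreal G.
Proof.
move=> ow nE; have [x nx] := nontrivial (e t); have [y ny] := nontrivial (e (negb t)).
have [z nz] := nontrivial w.
set g := iota (e t) x; set c := iota w z.
have Pg : P t g by apply: base_side; apply: e_negb.
have ng : ~ P (negb t) g by apply: base_not_side.
have Pc s : P s c by apply: base_side; apply: ow.
have [_ [PM PV]] := side_group (iota := iota) e t.
have [_ [PM' PV']] := side_group (iota := iota) e (negb t).
have key s : P t s -> ~ P (negb t) s -> ~ P (negb t) (mul (inv s) (mul c s)).
{ move=> Ps ns Pcs.
  have [h Hh] := side_stabilizer E_sym E_irr GP e e_neq e_nonadj t s Ps ns.
  have := Hh c (Pc _) (Pc _) Pcs.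
  pose R := retr GP (fun v => v = w); have hR : is_hom R := retr_hom GP _.
  move=> /(retr_trivial GP (fun v => v = w)) H.
  have : R (mul (inv h) (mul c h)) = one.
    by apply: H => v tv vw; apply: nE; rewrite -vw.
  have cR : R c = c by apply: (retr_in GP (fun v => v = w)).
  rewrite !hR (hom_inv _ _ hR) cR.
  move=> H1; apply: nz; apply: (iota_eq1 E_irr GP); rewrite -/c.
  by apply: (mulIg (R h)); apply: (mulgI (inv (R h))); rewrite H1; grp. }
have nPV s : ~ P (negb t) s -> ~ P (negb t) (inv s).
  by move=> n H; apply: n; rewrite -(invgK s); apply: PV'.
have drop_c s : P (negb t) (mul s (inv c)) -> P (negb t) s.
  by move=> H; have := PM' _ _ H (Pc _); grp.
apply: (arboreal_of_three_cosets t g (mul c (mul g (inv c))) (iota _ y)) => //.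
- exact: (PM _ _ (Pc t) (PM _ _ Pg (PV _ (Pc t)))).
- by move=> H; apply: ng; apply: drop_c; have := PM' _ _ (PV' _ (Pc _)) H; grp.
- by move=> H; apply: (key g Pg ng); apply: drop_c; move: H; grp.
- move=> H; apply: (key (inv g) (PV _ Pg) (nPV _ ng)); apply: drop_c; move: H; grp.
- by apply: base_side; rewrite negb_involutive => /einj; case: (t).
- by have := base_not_side (negb t) y ny; rewrite negb_involutive.
Qed.

(* The degenerate case: [G] is the product of a finite group with an infinite dihedral group. *)
Lemma dihedral_virtually_cyclic :
  (forall t (x x' : Gv (e t)), x <> one -> x' <> one -> x = x') ->
  (forall t w, others e w -> E (e t) w) -> virtually_cyclic G.
Proof.
move=> two adj.
have [x nx] := nontrivial (e true); have [y ny] := nontrivial (e false).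
have order2 t (z : Gv (e t)) : z <> one -> mul z z = one.
  move=> nz; apply: NNPP => n; apply: nz.
  have nz : z <> one by move=> E1; apply: n; rewrite E1 mulg1.
  by apply: (mulgI z); rewrite mulg1; apply: two.
set a := iota (e true) x; set b := iota (e false) y.
have aa : mul a a = one.
  by rewrite /a -(iota_hom GP) order2 // (hom_one _ (iota_hom GP _)).
have bb : mul b b = one.
  by rewrite /b -(iota_hom GP) order2 // (hom_one _ (iota_hom GP _)).
have comm t (z : Gv (e t)) c : in_full iota (others e) c ->
    mul (iota (e t) z) c = mul c (iota (e t) z).
  move=> fc; symmetry; apply: (full_centralizes (others e) _ _ c fc) => v u ov.
  by symmetry; apply: (iota_commute GP); apply: adj.
have [l Hl] := link_finite.
have Hl' c : in_full iota (others e) c -> In c l.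
  by move=> fc; apply: Hl; apply: full_mono fc => v ov; split; apply: adj.
exists (mul a b), (l ++ map (fun c => mul c a) l).
(* Here [c] ranges over a finite group commuting with [a] and [b]. As [a] and [b] are involutions,
   left multiplication by either exchanges the two forms, [b] also shifting the exponent. *)
suff normal g : exists c k, in_full iota (others e) c /\
    (g = mul c (gpow (mul a b) k) \/ g = mul c (mul a (gpow (mul a b) k))).
{ move=> g; have [c [k [fc [->|->]]]] := normal g.
    by exists c, k; split=> //; apply: in_or_app; left; apply: Hl'.
  exists (mul c a), k; split; last by rewrite mulA.
  by apply: in_or_app; right; apply: (in_map (fun c => mul c a)); apply: Hl'. }
elim/(full_left_ind GP (fun _ => True)): g / (graph_product_generated GP g) =>
  [|v z g _ _ [c [k [fc Hg]]]].
  by exists one, 0%Z; split; [exact: full_one | left; grp].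
have [[t Et]|ov] := othersP e v; last first.
  exists (mul (iota v z) c), k; split; first by apply: full_mul => //; apply: full_gen.
  by case: Hg => ->; [left | right]; rewrite mulA.
subst v; case: (classic (z = one)) => [->|nz].
  by exists c, k; rewrite (hom_one _ (iota_hom GP _)) mul1g.
case: t z nz => z nz.
  rewrite (two true z x nz nx) -/a; exists c, k; split=> //.
  case: Hg => ->; [right | left]; rewrite mulA comm // -/a -mulA //.
  by rewrite (mulA _ a a) aa mul1g.
rewrite (two false z y nz ny) -/b.
case: Hg => ->; rewrite mulA comm // -/b -mulA.
  exists c, (Z.succ k); split=> //; right.
  by rewrite gpow_succ -(mulA _ a b) (mulA _ a a) aa mul1g.
exists c, (Z.pred k); split=> //; left; rewrite gpow_pred invMg -(inv_unique _ _ aa).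
by rewrite -(inv_unique _ _ bb) -!mulA.
Qed.

Lemma separated_arboreal : ~ virtually_cyclic G -> acylindrically_arboreal G.
Proof.
move=> nvc; apply: NNPP => na; apply: nvc; apply: dihedral_virtually_cyclic.
  move=> t x x' nx nx'; apply: NNPP => ne; apply: na.
  exact: (arboreal_of_large_vertex_group t x x').
move=> t w ow; apply: NNPP => nE; apply: na.
exact: (arboreal_of_nonadjacent t w).
Qed.
End Backward.

(** * Arboreality and separated pairs: the two directions combined *)

Theorem theorem1p3 (V : Type) (E : V -> V -> Prop) (Gv : V -> group)
  (G : group) (iota : forall v, Gv v -> G) :
  (* Gamma is a finite simple graph *)
  (exists lV : list V, forall v, In v lV) ->
  (forall u v, E u v -> E v u) ->
  (forall v, ~ E v v) ->
  (* all groups countable *)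
  (forall v, countable (Gv v)) ->
  countable G ->
  (* G = GP(Gamma, G_v) *)
  is_graph_product E Gv G iota ->
  (* non-degenerate *)
  (forall v, exists x : Gv v, x <> one) ->
  (exists u v : V, u <> v) ->
  (* diam(Gamma) >= 2 *)
  diam_ge2 E ->
  acylindrically_arboreal G <->
  (~ virtually_cyclic G /\ exists a b : V, separated E iota a b).
Proof.
move=> _ E_sym E_irr _ _ GP nontrivial _ diam; split.
  move=> [T [adj [act [tree [action [acyl ne]]]]]].
  have [d [tm gm]] := is_tree_metric adj tree.
  split; first exact: (not_virtually_cyclic action d tm gm ne).
  exact: (separated_exists E_sym E_irr GP nontrivial tree action acyl diam ne).
move=> [nvc [a [b [/dist_ge2 [ab nE] fin]]]].
exact: (separated_arboreal E_sym E_irr GP nontrivial (fun t : bool => if t then a else b) ab nE fin).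
Qed.
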